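(* Let $F$ be a field of characteristic $p>0$ with $[F:F^p]=p^n$ for some integer $n\geq 1$. Let $K$ be a henselian discretely valued field of characteristic $p$ with residue field $F$. Suppose that $\alpha\in \mathrm{Br}(K)[p]$ satisfies $\mathrm{sw}(\alpha)>0$ and $p\nmid \mathrm{sw}(\alpha)$. Then $\mathrm{ind}(\alpha)$ divides $\mathrm{per}(\alpha)^n$.
   Context: $\mathrm{Br}(K)[p]$ is the $p$-torsion subgroup of the Brauer group; $\mathrm{per}$ and $\mathrm{ind}$ denote period and index of a Brauer class. Kato's Swan conductor: for a field $K$ and integers $m,q$, put $H^q_m(K)=H^q_{\text{ét}}(K,(\mathbb{Z}/m)(q-1))$, where for $m=p^s m'$ with $p\nmid m'$ one sets $(\mathbb{Z}/m)(r)=\mu_{m'}^{\otimes r}\oplus W_s\Omega^r_{\log}[-r]$ (logarithmic de Rham–Witt sheaf); in particular $H^2_p(K)=\mathrm{Br}(K)[p]$. For $K$ henselian discretely valued with valuation ring $\mathcal{O}_K$, maximal ideal $m_K$ and uniformizer $\pi$, define $\mathrm{fil}_n H^q_m(K)$ ($n\geq 0$) as the set of $\chi$ such that $\{\chi_L,1+\pi^{n+1}\mathcal{O}_L\}=\chi_L\cup\{1+\pi^{n+1}\mathcal{O}_L\}=0$ in $H^{q+1}_m(L)$ for every henselian discretely valued field $L\supseteq K$ with $\mathcal{O}_K\subset\mathcal{O}_L$ and $m_L=\mathcal{O}_L m_K$. The Swan conductor $\mathrm{sw}(\chi)$ is the least $n\geq 0$ with $\chi\in \mathrm{fil}_n H^q_m(K)$.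 (In characteristic $p$, identifying $\mathrm{Br}(K)[p]\cong \Omega^1_K/((\mathrm{Fr}-1)\Omega^1_K+dK)$, $\mathrm{fil}_j$ is the subgroup generated by classes $a\,\frac{db}{b}$ with $a\in K$, $b\in K^\times$, $v(a)\geq -j$.) *)

(* Defs.v *)
From HB Require Import structures.
From mathcomp Require Import all_boot all_order all_algebra all_field.

Set Implicit Arguments.
Unset Strict Implicit.
Unset Printing Implicit Defensive.

Import Order.TTheory GRing.Theory Num.Theory.
Local Open Scope ring_scope.

(* [F : F^p] = d: some e is a basis of F over its subfield F^p.  The
   coefficients c i ^+ p determine c because Frobenius is injective. *)
Definition frob_degree (F : fieldType) (p d : nat) : Prop :=
  exists e : 'I_d -> F, forall x : F,
    exists! c : {ffun 'I_d -> F}, x = \sum_(i < d) c i ^+ p * e i.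

(* Normalized discrete valuations; the value v 0 is irrelevant. *)
Record discrete_valuation (K : fieldType) (v : K -> int) : Prop := {
  dvalM : forall x y, x != 0 -> y != 0 -> v (x * y) = v x + v y;
  dvalD : forall x y, x != 0 -> y != 0 -> x + y != 0 ->
            Num.min (v x) (v y) <= v (x + y);
  dval_unif : exists2 pi, pi != 0 & v pi = 1
}.

(* v x >= k, with the convention v 0 = +oo. *)
Definition val_ge (K : fieldType) (v : K -> int) (k : int) (x : K) : bool :=
  (x == 0) || (k <= v x).

Definition val_ring (K : fieldType) (v : K -> int) : {pred K} :=
  [pred x | val_ge v 0 x].

Definition val_max (K : fieldType) (v : K -> int) : {pred K} :=
  [pred x | val_ge v 1 x].

Definition henselian (K : fieldType) (v : K -> int) : Prop :=
  forall (f : {poly K}) (a : K),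
    f \is monic -> f \is a polyOver (val_ring v) -> a \in val_ring v ->
    f.[a] \in val_max v -> f^`().[a] \notin val_max v ->
    exists2 b, b \in val_ring v & root f b /\ b - a \in val_max v.

(* r restricts to a surjective ring morphism O_K -> F with kernel m_K; its
   values outside O_K are irrelevant. *)
Record residue_map (K F : fieldType) (v : K -> int) (r : K -> F) : Prop := {
  res1 : r 1 = 1;
  resD : {in val_ring v &, forall x y, r (x + y) = r x + r y};
  resM : {in val_ring v &, forall x y, r (x * y) = r x * r y};
  res_surj : forall y, exists2 x, x \in val_ring v & r x = y;
  res_ker : {in val_ring v, forall x, (r x == 0) = (x \in val_max v)}
}.

Definition residue_field (K : fieldType) (v : K -> int) (F : fieldType) : Prop :=
  exists r : K -> F, residue_map v r.

Section Brauer.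

Variable K : fieldType.
Implicit Types A B C D T S : falgType K.

(* Nonzeroness is part of falgType. *)
Definition central_simple A : Prop :=
  (forall z : A, (forall x, z * x = x * z) -> exists c : K, z = c%:A) /\
  (forall I : {vspace A},
     (forall a x, x \in I -> a * x \in I /\ x * a \in I) ->
     I = 0%VS \/ I = fullv).

(* T is a tensor product of A and B over K: A and B map to commuting
   subalgebras of T, and the induced linear map A (x) B -> T is bijective. *)
Definition is_tensor A B T : Prop :=
  exists (f : {lrmorphism A -> T}) (g : {lrmorphism B -> T}),
    (forall a b, f a * g b = g b * f a) /\
    basis_of fullv [seq f a * g b | a <- vbasis {:A}, b <- vbasis {:B}].

(* A (x) M_r(K) and B (x) M_s(K) are isomorphic for some r, s >= 1.  A class of
   Br(K) is represented by a central simple algebra up to brauer_eq; addition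
   is induced by is_tensor and the zero class is that of K. *)
Definition brauer_eq A B : Prop :=
  exists (r s : nat) (C : falgType K),
    is_tensor A 'M[K]_r.+1 C /\ is_tensor B 'M[K]_s.+1 C.

Definition brauer_zero A : Prop := brauer_eq A (K^o : falgType K).

Fixpoint is_tensor_power (k : nat) A T : Prop :=
  if k is k'.+1
  then exists C : falgType K, is_tensor_power k' A C /\ is_tensor A C T
  else exists f : {lrmorphism (K^o : falgType K) -> T}, bijective f.

Definition brauer_torsion (k : nat) A : Prop :=
  exists T : falgType K, is_tensor_power k A T /\ brauer_zero T.

Definition is_period A (e : nat) : Prop :=
  [/\ (0 < e)%N, brauer_torsion e A &
      forall k, (0 < k)%N -> brauer_torsion k A -> (e <= k)%N].

Definition is_index A (d : nat) : Prop :=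
  exists D : falgType K,
    [/\ central_simple D, forall x : D, x != 0 -> x \is a GRing.unit,
        brauer_eq A D & \dim {:D} = (d ^ 2)%N].

(* The central simple algebras whose class lies in the subgroup of Br(K)
   generated by the classes of the algebras satisfying G. *)
Inductive brauer_gen (G : falgType K -> Prop) : falgType K -> Prop :=
| brauer_gen_base A : G A -> brauer_gen G A
| brauer_gen0 : brauer_gen G (K^o : falgType K)
| brauer_genD A B T :
    brauer_gen G A -> brauer_gen G B -> is_tensor A B T -> brauer_gen G T
| brauer_genN A B T :
    brauer_gen G A -> central_simple B ->
    is_tensor A B T -> brauer_zero T -> brauer_gen G B
| brauer_gen_eq A B :
    brauer_gen G A -> central_simple B -> brauer_eq A B -> brauer_gen G B.

(* The p-algebra [a, b): generators x, y with x^p - x = a, y^p = b and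
   y x = (x + 1) y, with K-basis the x^i y^j for 0 <= i, j < p. *)
Definition is_symbol_algebra (p : nat) (a b : K) S : Prop :=
  exists x y : S,
    [/\ x ^+ p - x = a%:A, y ^+ p = b%:A, y * x = (x + 1) * y &
        basis_of fullv [seq x ^+ i * y ^+ j | i <- iota 0 p, j <- iota 0 p]].

(* In characteristic p, the isomorphism
     Omega^1_K / ((Fr - 1) Omega^1_K + dK) -> Br(K)[p]
   sends the class of a db/b to the class of [a, b).  Hence fil_j, generated by
   the a db/b with v(a) >= -j, is the subgroup generated by these [a, b).
   Replacing [a, b) by its inverse [-a, b) (the other sign convention for the
   isomorphism) gives the same subgroup. *)
Definition swan_generator (v : K -> int) (p j : nat) S : Prop :=
  exists a b : K,
    [/\ val_ge v (- j%:Z) a, b != 0 & is_symbol_algebra p a b S].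

Definition swan_fil (v : K -> int) (p j : nat) : falgType K -> Prop :=
  brauer_gen (swan_generator v p j).

Definition is_swan (v : K -> int) (p : nat) A (m : nat) : Prop :=
  swan_fil v p m A /\ forall j, swan_fil v p j A -> (m <= j)%N.

End Brauer.

(* Main.v *)
Require Import Defs.
From HB Require Import structures.
From Stdlib Require Import ClassicalEpsilon.
From mathcomp Require Import all_boot all_order all_algebra all_field.
From mathcomp Require Import zify.
Import Order.TTheory GRing.Theory Num.Theory VectorInternalTheory.

Set Implicit Arguments.
Unset Strict Implicit.
Unset Printing Implicit Defensive.

Local Open Scope ring_scope.

(* Write {a, b} for the Brauer class of [a, b). Changing generators inside a
   tensor product of two symbol algebras, and inside one, shows that {a, b} is
   biadditive, that {c^p - c, b} = 0 and that {a, a} = 0. Consequently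
   c db := {cb, b} = - {cb, c} is biadditive and satisfies the Leibniz rule.

   Let t_1, ..., t_n lift generators of the residue field F over F^p and let pi
   be a uniformizer. By the Leibniz rule every element of fil_j is, modulo
   fil_(j-1), of the form sum_k {c_k, t_k} + {c, pi} with v(c_k), v(c) >= -j, and
   the term {c, pi} can be removed if p does not divide j. So, m being the Swan
   conductor, the class is sum_k {a_k, t_k} modulo fil_(m-1), with v(a_k) = -m
   for some k = k0. Going down from j = m - 1 to j = 0, one absorbs the part of
   degree j: the {c_k, t_k} by changing a_k, and {c, pi}, when p divides j, by
   multiplying the second entry of the k0-th symbol by 1 + w with a_k0 w = c up to
   the scalar m - j, which is prime to p. Finally fil_(-1) = 0 by Hensel's lemma.
   The class is thus a sum of n symbols, so that its index divides p^n; it is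
   nonzero as its Swan conductor is positive, so that its period is p. *)

(** The relations between symbols rest on one recognition principle: two commuting pairs of
    generators in an algebra of dimension p^4 present it as a tensor product of two symbol algebras.
    Injectivity comes from the freeness of the monomials x^i y^j over the centralizer of x and y,
    and surjectivity from counting dimensions.

    The obstacle in the descent is {c, pi} in a degree j divisible by p: with c = pi^(-j) u, the
    relation {c, c} = 0 only yields j {c, pi} = {c, u}, where j is zero modulo p. The symbol with
    the pole of order m supplies the missing freedom. To first order {a, 1 + w} is a dw = {aw, w},
    and for w = pi^(m-j) u this contains (m - j) {aw, pi}, whose scalar is invertible because p
    divides j but not m. The factor 1 + w leaves the second entry congruent to t_k0 modulo the
    maximal ideal, as the later steps require, and no further symbol with second entry pi is
    created, so that n symbols are enough.

    The descent is done in an arbitrary abelian group with a symbol obeying the relations, and is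
    then applied to Brauer classes of lists of symbols. *)

(** * Tensor products of finite-dimensional algebras *)

Section TensorProduct.

Variable K : fieldType.
Implicit Types A B C T : falgType K.

Definition algebra_morphism A B (f : A -> B) : Prop :=
  [/\ linear f, {morph f : x y / x * y} & f 1 = 1].

Lemma algebra_morphismP A B (f : A -> B) :
  algebra_morphism f -> exists F : {lrmorphism A -> B}, forall x, f x = F x.
Proof.
case=> lf mf f1.
pose L := GRing.isLinear.Build K A B _ f lf.
pose M := GRing.isMonoidMorphism.Build A B f (f1, mf).
pose F : {lrmorphism A -> B} := HB.pack f L M.
by exists F.
Qed.

Lemma lrmorphism_algebra_morphism A B (f : {lrmorphism A -> B}) :
  algebra_morphism f.
Proof. by split; [exact: linearP | exact: rmorphM | exact: rmorph1]. Qed.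

(** The entries of the matrix are the coordinates on the products of basis vectors of [A] and [B],
    so that the vector space structure and the dimension are those of matrices, and a pure tensor is
    a matrix of rank at most one. *)
Definition tensor_type A B := 'M[K]_(dim A, dim B).

HB.instance Definition _ A B := Vector.on (tensor_type A B).

Section Construction.

Variables A B : falgType K.

Definition tpure (a : A) (b : B) : tensor_type A B := (v2r a)^T *m v2r b.

Lemma tpureDl b : {morph tpure^~ b : x y / x + y}.
Proof. by move=> x y; rewrite /tpure linearD /= linearD /= mulmxDl. Qed.
Lemma tpureDr a : {morph tpure a : x y / x + y}.
Proof. by move=> x y; rewrite /tpure linearD /= mulmxDr. Qed.
Lemma tpureZl b c a : tpure (c *: a) b = c *: tpure a b.
Proof. by rewrite /tpure linearZ /= linearZ /= scalemxAl. Qed.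
Lemma tpureZr a c b : tpure a (c *: b) = c *: tpure a b.
Proof. by rewrite /tpure linearZ /= scalemxAr. Qed.

Definition tensor_lbasis (i : 'I_(dim A)) : A := r2v (delta_mx 0 i).
Definition tensor_rbasis (i : 'I_(dim B)) : B := r2v (delta_mx 0 i).

Lemma tensor_sum (M : tensor_type A B) :
  M = \sum_i \sum_j M i j *: tpure (tensor_lbasis i) (tensor_rbasis j).
Proof.
rewrite {1}[M]matrix_sum_delta; apply: eq_bigr => i _; apply: eq_bigr => j _.
by rewrite /tpure !r2vK trmx_delta mul_delta_mx.
Qed.

(** Scalars are absorbed by the first factor of a pure tensor and zero is itself pure, so sums and
    pure tensors are the only cases. *)
Lemma tensor_ind (P : tensor_type A B -> Prop) :
  (forall x y, P x -> P y -> P (x + y)) -> (forall a b, P (tpure a b)) ->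
  forall x, P x.
Proof.
move=> PD Pp x; have P0 : P 0.
  suff -> : 0 = tpure 0 0 by [].
  by rewrite -[X in tpure X _](scale0r 0) tpureZl scale0r.
rewrite (tensor_sum x); elim/big_ind: _ => // i _; elim/big_ind: _ => // j _.
by rewrite -tpureZl.
Qed.

Definition tensor_ext (V : lmodType K) (phi : A -> B -> V)
    (M : tensor_type A B) : V :=
  \sum_i \sum_j M i j *: phi (tensor_lbasis i) (tensor_rbasis j).

Definition bilinear_map (V : lmodType K) (phi : A -> B -> V) : Prop :=
  (forall a, linear (phi a)) /\ (forall b, linear (phi^~ b)).

Lemma tensor_ext_linear (V : lmodType K) (phi : A -> B -> V) :
  linear (tensor_ext phi).
Proof.
move=> c x y; rewrite /tensor_ext scaler_sumr -big_split /=.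
apply: eq_bigr => i _; rewrite scaler_sumr -big_split /=; apply: eq_bigr => j _.
by rewrite !mxE scalerDl scalerA.
Qed.

Lemma tensor_extE (V : lmodType K) (phi : A -> B -> V) a b :
  bilinear_map phi -> tensor_ext phi (tpure a b) = phi a b.
Proof.
case=> lphir lphil.
have defA : a = \sum_i v2r a 0 i *: tensor_lbasis i.
  apply: v2r_inj; rewrite linear_sum /= {1}[v2r a]row_sum_delta.
  by apply: eq_bigr => i _; rewrite linearZ /= r2vK.
have defB : b = \sum_i v2r b 0 i *: tensor_rbasis i.
  apply: v2r_inj; rewrite linear_sum /= {1}[v2r b]row_sum_delta.
  by apply: eq_bigr => i _; rewrite linearZ /= r2vK.
pose F b : {linear A -> V} :=
  HB.pack (phi^~ b) (GRing.isLinear.Build K A V _ (phi^~ b) (lphil b)).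
pose G a : {linear B -> V} :=
  HB.pack (phi a) (GRing.isLinear.Build K B V _ (phi a) (lphir a)).
rewrite {2}defA -[RHS]/(F b _) linear_sum; apply: eq_bigr => i _.
rewrite linearZ /= {2}defB -[phi _ _]/(G _ _) linear_sum scaler_sumr.
apply: eq_bigr => j _; rewrite linearZ /= scalerA; congr (_ *: _).
by rewrite /tpure mxE big_ord1 mxE.
Qed.

Definition tensor_mul (x y : tensor_type A B) : tensor_type A B :=
  tensor_ext (fun a b => tensor_ext (fun a' b' => tpure (a * a') (b * b')) y) x.

Lemma tensor_mul_linearl y : linear (tensor_mul^~ y).
Proof. exact: tensor_ext_linear. Qed.

Lemma bilinear_tpureM a b :
  bilinear_map (fun a' b' => tpure (a * a') (b * b')).
Proof.
split=> [a' c x y|b' c x y].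
  by rewrite mulrDr -scalerAr tpureDr tpureZr.
by rewrite mulrDr -scalerAr tpureDl tpureZl.
Qed.

Lemma bilinear_tensor_mul y :
  bilinear_map (fun a b => tensor_ext (fun a' b' => tpure (a * a') (b * b')) y).
Proof.
split=> [a c x z|b c x z].
  rewrite /tensor_ext scaler_sumr -big_split; apply: eq_bigr => i _ /=.
  rewrite scaler_sumr -big_split; apply: eq_bigr => j _ /=.
  by rewrite mulrDl -scalerAl tpureDr tpureZr scalerDr !scalerA mulrC.
rewrite /tensor_ext scaler_sumr -big_split; apply: eq_bigr => i _ /=.
rewrite scaler_sumr -big_split; apply: eq_bigr => j _ /=.
by rewrite mulrDl -scalerAl tpureDl tpureZl scalerDr !scalerA mulrC.
Qed.

Lemma tensor_mul_linearr x : linear (tensor_mul x).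
Proof.
move=> c y z; rewrite /tensor_mul {1 3 5}/tensor_ext scaler_sumr -big_split.
apply: eq_bigr => i _ /=; rewrite scaler_sumr -big_split; apply: eq_bigr => j _ /=.
by rewrite tensor_ext_linear scalerDr !scalerA mulrC.
Qed.

Lemma tensor_mulE a b a' b' :
  tensor_mul (tpure a b) (tpure a' b') = tpure (a * a') (b * b').
Proof.
rewrite /tensor_mul tensor_extE; last exact: bilinear_tensor_mul.
by rewrite tensor_extE //; exact: bilinear_tpureM.
Qed.

Lemma tensor_mulDl : left_distributive tensor_mul +%R.
Proof.
by move=> x y z; have := tensor_mul_linearl z 1 x y; rewrite !scale1r.
Qed.
Lemma tensor_mulDr : right_distributive tensor_mul +%R.
Proof.
by move=> x y z; have := tensor_mul_linearr x 1 y z; rewrite !scale1r.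
Qed.

Lemma tensor_mulA : associative tensor_mul.
Proof.
move=> x y z; elim/tensor_ind: x => [u v hu hv|a b]; first by rewrite !tensor_mulDl hu hv.
elim/tensor_ind: y => [u v hu hv|a' b'].
  by rewrite !(tensor_mulDl, tensor_mulDr) hu hv.
elim/tensor_ind: z => [u v hu hv|a'' b''].
  by rewrite !(tensor_mulDl, tensor_mulDr) hu hv.
by rewrite !tensor_mulE !mulrA.
Qed.

Lemma tensor_mul1 : left_id (tpure 1 1) tensor_mul.
Proof.
elim/tensor_ind => [u v hu hv|a b]; first by rewrite !tensor_mulDr hu hv.
by rewrite tensor_mulE !mul1r.
Qed.

Lemma tensor_mulr1 : right_id (tpure 1 1) tensor_mul.
Proof.
elim/tensor_ind => [u v hu hv|a b]; first by rewrite !tensor_mulDl hu hv.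
by rewrite tensor_mulE !mulr1.
Qed.

Lemma tpure_eq0 a b : tpure a b = 0 -> a = 0 \/ b = 0.
Proof.
move=> ab0; have [->|a0] := eqVneq a 0; first by left.
right; apply: v2r_inj; rewrite linear0; apply/rowP => j; rewrite !mxE.
have [i ai] : exists i, v2r a 0 i != 0.
  apply/existsP; rewrite -negb_forall; apply: contra a0 => /forallP h.
  by apply/eqP/v2r_inj/rowP => i; rewrite linear0 mxE; exact/eqP.
have := congr1 (fun M : 'M__ => M i j) ab0; rewrite !mxE big_ord1 !mxE.
by move/eqP; rewrite mulf_eq0 (negPf ai) => /eqP.
Qed.

Lemma tpure1_neq0 : tpure 1 1 != 0.
Proof. by apply/eqP => /tpure_eq0 [] /eqP; rewrite oner_eq0. Qed.

HB.instance Definition _ := GRing.Zmodule_isNzRing.Build (tensor_type A B)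
  tensor_mulA tensor_mul1 tensor_mulr1 tensor_mulDl tensor_mulDr tpure1_neq0.

Lemma tensor_scaleAl c (x y : tensor_type A B) : c *: (x * y) = c *: x * y.
Proof.
have := tensor_mul_linearl y c x 0; rewrite addr0 => h.
have := tensor_mul_linearl y 0 0 0; rewrite !scale0r !add0r => h0.
rewrite -[RHS]/(tensor_mul _ y) h.
by rewrite -[tensor_mul 0 y]/(0 * y) mul0r addr0.
Qed.

HB.instance Definition _ :=
  GRing.Lmodule_isLalgebra.Build K (tensor_type A B) tensor_scaleAl.

Lemma tensor_scaleAr c (x y : tensor_type A B) : c *: (x * y) = x * (c *: y).
Proof.
have := tensor_mul_linearr x c y 0; rewrite addr0 => h.
rewrite -[RHS]/(tensor_mul x _) h.
by rewrite -[tensor_mul x 0]/(x * 0) mulr0 addr0.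
Qed.

HB.instance Definition _ :=
  GRing.Lalgebra_isAlgebra.Build K (tensor_type A B) tensor_scaleAr.

HB.instance Definition _ := Algebra_isFalgebra.Build K (tensor_type A B).

End Construction.

Definition tensor A B : falgType K := tensor_type A B.

Lemma tpureM A B a b a' b' :
  tpure a b * tpure a' b' = tpure (a * a') (b * b') :> tensor A B.
Proof. exact: tensor_mulE. Qed.

Lemma tpure11 A B : tpure 1 1 = 1 :> tensor A B.
Proof. by []. Qed.

Lemma dim_tensor A B : dim (tensor A B) = (dim A * dim B)%N.
Proof. by []. Qed.

End TensorProduct.

(** * Isomorphisms of algebras, tensor products and matrix algebras *)

Section Isomorphism.

Variable K : fieldType.
Implicit Types A B C T : falgType K.

Definition iso A B : Prop :=
  exists f : A -> B, algebra_morphism f /\ bijective f.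

Lemma iso_refl A : iso A A.
Proof. by exists id; split; [split | exists id]. Qed.

Lemma iso_sym A B : iso A B -> iso B A.
Proof.
case=> f [[lf mf f1] [g fK gK]]; exists g; split; last by exists f.
split=> [c x y|x y|]; apply: (can_inj fK).
- by rewrite gK lf !gK.
- by rewrite gK mf !gK.
- by rewrite gK f1.
Qed.

Lemma iso_trans A B C : iso A B -> iso B C -> iso A C.
Proof.
case=> f [[lf mf f1] bf] [g [[lg mg g1] bg]]; exists (g \o f).
split; last exact: bij_comp.
by split=> [c x y|x y|] /=; rewrite ?lf ?lg ?mf ?mg ?f1 ?g1.
Qed.

Lemma linear_bij_dim (U V : vectType K) (f : {linear U -> V}) :
  bijective f -> dim U = dim V.
Proof.
move=> bf; have kf : lker (linfun f) == 0%VS.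
  by apply/lker0P => x y; rewrite !lfunE; exact: (bij_inj bf).
rewrite -!dimvf -(limg_dim_eq (f := linfun f)); last by rewrite (eqP kf) capv0.
congr (\dim _); apply/vspaceP => y; rewrite memvf; apply/memv_imgP.
by case: bf => g _ gK; exists (g y); rewrite ?memvf // lfunE gK.
Qed.

Lemma iso_dim A B : iso A B -> dim A = dim B.
Proof.
case=> f [/algebra_morphismP [F fF] bf]; apply: (linear_bij_dim (f := F)).
exact: eq_bij bf _ fF.
Qed.

Lemma iso_of_inj A B (f : A -> B) :
  algebra_morphism f -> (forall x, f x = 0 -> x = 0) -> (dim B <= dim A)%N ->
  iso A B.
Proof.
move=> mf injf leBA; exists f; split=> //; have [F fF] := algebra_morphismP mf.
have kF : lker (linfun F) == 0%VS.
  rewrite -subv0; apply/subvP => x; rewrite memv_ker lfunE /= -fF.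
  by move/eqP/injf->; rewrite mem0v.
have surj y : y \in limg (linfun F).
  suff -> : limg (linfun F) = fullv by rewrite memvf.
  apply/eqP; rewrite eqEdim subvf dimvf limg_dim_eq ?dimvf //.
  by rewrite (eqP kF) capv0.
exists (linfun F)^-1%VF => [x|y].
  by rewrite fF -[F x]lfunE /= lker0_lfunK.
by rewrite fF -[F _]lfunE /= limg_lfunVK.
Qed.

Lemma iso_of_surj A B (f : A -> B) :
  algebra_morphism f -> (forall y, exists x, f x = y) -> (dim A <= dim B)%N ->
  iso A B.
Proof.
move=> mf surjf leAB; have [F fF] := algebra_morphismP mf.
have imF : limg (linfun F) = fullv.
  apply/vspaceP => y; rewrite memvf; apply/memv_imgP; have [x <-] := surjf y.
  by exists x; rewrite ?memvf // lfunE fF.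
have ker0 : \dim (lker (linfun F)) = 0%N.
  have := limg_ker_dim (linfun F) fullv; rewrite imF !dimvf capfv.
  by move=> h; apply/eqP; rewrite -leqn0 -(leq_add2r (dim B)) h.
apply: (iso_of_inj mf) => [x fx0|].
  have : x \in lker (linfun F) by rewrite memv_ker lfunE /= -fF fx0.
  by move/eqP: ker0; rewrite dimv_eq0 => /eqP->; rewrite memv0 => /eqP.
by have := limg_ker_dim (linfun F) fullv; rewrite imF !dimvf capfv ker0 => <-.
Qed.

Section TensorMap.

Variables (A B T : falgType K) (f : A -> T) (g : B -> T).
Hypotheses (mf : algebra_morphism f) (mg : algebra_morphism g).
Hypothesis fg : forall a b, f a * g b = g b * f a.

Definition tensor_map : tensor A B -> T := tensor_ext (fun a b => f a * g b).

Lemma bilinear_tensor_map : bilinear_map (fun a b => f a * g b).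
Proof.
case: mf => lf _ _; case: mg => lg _ _.
split=> [a c x y|b c x y]; first by rewrite lg mulrDr -scalerAr.
by rewrite lf mulrDl -scalerAl.
Qed.

Lemma tensor_mapE a b : tensor_map (tpure a b) = f a * g b.
Proof. exact: tensor_extE bilinear_tensor_map. Qed.

Lemma tensor_map_linear : linear tensor_map.
Proof. exact: tensor_ext_linear. Qed.

Lemma tensor_mapD : {morph tensor_map : x y / x + y}.
Proof. by move=> x y; have := tensor_map_linear 1 x y; rewrite !scale1r. Qed.

Lemma tensor_map_morphism : algebra_morphism tensor_map.
Proof.
case: (mf) => _ mmf f1; case: (mg) => _ mmg g1.
split; first exact: tensor_map_linear.
  move=> x y; elim/tensor_ind: x => [u v hu hv|a b].
    by rewrite !(mulrDl, tensor_mapD) hu hv.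
  elim/tensor_ind: y => [u v hu hv|a' b'].
    by rewrite !(mulrDr, tensor_mapD) hu hv.
  by rewrite tpureM !tensor_mapE mmf mmg -!mulrA (mulrA (f a')) fg !mulrA.
by rewrite -tpure11 tensor_mapE f1 g1 mulr1.
Qed.

End TensorMap.

Definition tensor_inl A B (a : A) : tensor A B := tpure a 1.
Definition tensor_inr A B (b : B) : tensor A B := tpure 1 b.

Lemma tensor_inl_morphism A B : algebra_morphism (@tensor_inl A B).
Proof.
split=> [c x y|x y|//]; rewrite /tensor_inl; first by rewrite tpureDl tpureZl.
by rewrite tpureM mulr1.
Qed.

Lemma tensor_inr_morphism A B : algebra_morphism (@tensor_inr A B).
Proof.
split=> [c x y|x y|//]; rewrite /tensor_inr; first by rewrite tpureDr tpureZr.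
by rewrite tpureM mulr1.
Qed.

Lemma tensor_inlr A B (a : A) (b : B) :
  tensor_inl B a * tensor_inr A b = tpure a b.
Proof. by rewrite tpureM mulr1 mul1r. Qed.

Lemma tensor_inrl A B (a : A) (b : B) :
  tensor_inr A b * tensor_inl B a = tpure a b.
Proof. by rewrite tpureM mulr1 mul1r. Qed.

Lemma morphism_comp A B C (f : A -> B) (g : B -> C) :
  algebra_morphism f -> algebra_morphism g -> algebra_morphism (g \o f).
Proof.
case=> lf mf f1 [lg mg g1].
by split=> [c x y|x y|] /=; rewrite ?lf ?lg ?mf ?mg ?f1 ?g1.
Qed.

(* The image contains the products f a * g b, which is all that surjectivity
   requires, as images of sums are sums. *)
Lemma tensor_iso A B T (f : A -> T) (g : B -> T) :
  algebra_morphism f -> algebra_morphism g ->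
  (forall a b, f a * g b = g b * f a) ->
  (forall P : T -> Prop, (forall x y, P x -> P y -> P (x + y)) ->
     (forall a b, P (f a * g b)) -> forall x, P x) ->
  dim T = (dim A * dim B)%N -> iso (tensor A B) T.
Proof.
move=> mf mg fg gen dT; apply: (iso_of_surj (tensor_map_morphism mf mg fg)).
  apply: gen => [x y [u <-] [w <-]|a b].
    by exists (u + w); rewrite tensor_mapD.
  by exists (tpure a b); rewrite tensor_mapE.
by rewrite dim_tensor dT.
Qed.

Lemma tensorC A B : iso (tensor A B) (tensor B A).
Proof.
apply: (tensor_iso (tensor_inr_morphism _ _) (tensor_inl_morphism _ _)).
- by move=> a b; rewrite tensor_inlr tensor_inrl.
- move=> P PD Pp; apply: tensor_ind => // a b.
  by rewrite -tensor_inrl.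
by rewrite !dim_tensor mulnC.
Qed.

Lemma tensor_congr A A' B B' :
  iso A A' -> iso B B' -> iso (tensor A B) (tensor A' B').
Proof.
move=> isoA isoB; have dA := iso_dim isoA; have dB := iso_dim isoB.
case: isoA => f [mf [f' _ fK]]; case: isoB => g [mg [g' _ gK]].
apply: (tensor_iso (morphism_comp mf (tensor_inl_morphism _ _))
                   (morphism_comp mg (tensor_inr_morphism _ _))).
- by move=> a b /=; rewrite tensor_inlr tensor_inrl.
- move=> P PD Pp; apply: tensor_ind => // a b.
  by rewrite -tensor_inlr -[a]fK -[b]gK; exact: Pp.
by rewrite !dim_tensor dA dB.
Qed.

Lemma tensorA A B C : iso (tensor A (tensor B C)) (tensor (tensor A B) C).
Proof.
apply: iso_sym.
pose h := tensor_map (@tensor_inl A (tensor B C))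
            (@tensor_inr A (tensor B C) \o @tensor_inl B C).
have mi := tensor_inl_morphism A (tensor B C).
have mr := tensor_inr_morphism A (tensor B C).
have mrl := morphism_comp (tensor_inl_morphism B C) mr.
have cm a b : tensor_inl (tensor B C) a *
   (@tensor_inr A (tensor B C) \o @tensor_inl B C) b =
   (@tensor_inr A (tensor B C) \o @tensor_inl B C) b * tensor_inl (tensor B C) a.
  by rewrite /= tensor_inlr tensor_inrl.
apply: (tensor_iso (tensor_map_morphism mi mrl cm)
                   (morphism_comp (tensor_inr_morphism B C) mr)).
- move=> x c /=; elim/tensor_ind: x => [u v hu hv|a b].
    by rewrite tensor_mapD mulrDl mulrDr hu hv.
  rewrite tensor_mapE //= /tensor_inl /tensor_inr !tpureM.
  by rewrite !(mulr1, mul1r).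
- move=> P PD Pp; apply: tensor_ind => // a; apply: tensor_ind => [x y hx hy|b c].
    by rewrite tpureDr; apply: PD.
  have := Pp (tpure a b) c; rewrite tensor_mapE //= /tensor_inl /tensor_inr !tpureM.
  by rewrite !(mulr1, mul1r).
by rewrite !dim_tensor mulnA.
Qed.

Lemma tensor1 A : iso (tensor A (K^o : falgType K)) A.
Proof.
have mi : algebra_morphism (fun c : (K^o : falgType K) => c *: (1 : A)).
  split=> [c x y|x y|]; rewrite ?scale1r //.
    by rewrite scalerDl scalerA.
  by rewrite -scalerAl mul1r scalerA.
apply: (tensor_iso (f := id) _ mi) => //.
- by move=> a b; rewrite -scalerAl -scalerAr mul1r mulr1.
- by move=> P PD Pp x; have := Pp x 1; rewrite scale1r mulr1.
by rewrite -[dim K^o]/1%N muln1.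
Qed.

Lemma size_vbasisf A : size (vbasis {:A}) = dim A.
Proof. by rewrite size_tuple dimvf. Qed.


Lemma span_ind (V : vectType K) (X : seq V) (P : V -> Prop) :
  P 0 -> (forall x y, P x -> P y -> P (x + y)) ->
  (forall c x, x \in X -> P (c *: x)) -> forall x, x \in <<X>>%VS -> P x.
Proof.
move=> P0 PD PZ x; rewrite -[X]in_tupleE => /coord_span->.
by elim/big_ind: _ => // i _; apply: PZ; rewrite mem_nth.
Qed.

(** This reduces [is_tensor] to the constructed tensor product, so that everything that follows is a
    computation up to [iso]. *)
Lemma is_tensorP A B T : is_tensor A B T <-> iso (tensor A B) T.
Proof.
split=> [[f [g [fg]]]|].
  set s := flatten _ => bas.
  have mf := lrmorphism_algebra_morphism f.
  have mg := lrmorphism_algebra_morphism g.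
  have ss : size s = (dim A * dim B)%N by rewrite size_allpairs !size_vbasisf.
  apply: (tensor_iso mf mg fg).
    move=> P PD Pp x; have P0 : P 0 by have := Pp 0 0; rewrite linear0 mul0r.
    have : x \in <<s>>%VS by rewrite (span_basis bas) memvf.
    apply: span_ind => // c y /allpairsP[[a b] /= [_ _ ->]].
    by have := Pp (c *: a) b; rewrite linearZ -scalerAl.
  by rewrite -ss -dimvf; apply: (@size_basis _ _ _ _ (in_tuple s)).
case=> h [mh bh]; have dT : dim (tensor A B) = dim T by apply: iso_dim; exists h.
have [f fE] := algebra_morphismP (morphism_comp (tensor_inl_morphism A B) mh).
have [g gE] := algebra_morphismP (morphism_comp (tensor_inr_morphism A B) mh).
have [lh mmh h1] := mh; have fg a b : f a * g b = h (tpure a b).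
  by rewrite -fE -gE /= -mmh tensor_inlr.
exists f, g; split=> [a b|].
  by rewrite fg -fE -gE /= -mmh tensor_inrl.
set s := flatten _.
have ss : size s = (dim A * dim B)%N by rewrite size_allpairs !size_vbasisf.
rewrite basisEdim ss dimvf -dT dim_tensor leqnn andbT.
have [h' _ hK] := bh; apply/subvP => x _; rewrite -[x]hK.
elim/tensor_ind: (h' x) => [u w hu hw|a b].
  by have := lh 1 u w; rewrite !scale1r => ->; rewrite memvD.
rewrite -fg (coord_vbasis (memvf a)) (coord_vbasis (memvf b)) !linear_sum mulr_suml.
apply: memv_suml => i _; rewrite mulr_sumr; apply: memv_suml => j _.
rewrite !linearZ /= -scalerAl -scalerAr !memvZ // memv_span //.
apply/allpairsP; exists ((vbasis {:A})`_i, (vbasis {:B})`_j).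
by rewrite !mem_nth ?size_tuple.
Qed.

(** The map sending [M] to the sum of the [M i j *: E i j] is injective because multiplying by
    [E i i] on the left and [E j j] on the right isolates the entry [M i j]; the dimension does the
    rest. *)
Lemma matrix_units_iso (q : nat) T (E : 'I_q.+1 -> 'I_q.+1 -> T) :
  (forall i j k l, E i j * E k l = if j == k then E i l else 0) ->
  \sum_i E i i = 1 -> dim T = (q.+1 * q.+1)%N -> iso T 'M[K]_q.+1.
Proof.
move=> EE sE dT; pose f (M : 'M[K]_q.+1) : T := \sum_i \sum_j M i j *: E i j.
have fE i j M : E i i * f M * E j j = M i j *: E i j.
  rewrite /f mulr_sumr mulr_suml (bigD1 i) //= [X in _ + X]big1 ?addr0.
    rewrite mulr_sumr mulr_suml (bigD1 j) //= [X in _ + X]big1 ?addr0.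
      by rewrite -scalerAr -scalerAl EE eqxx EE eqxx.
    by move=> l lj; rewrite -scalerAr -scalerAl EE eqxx EE (negPf lj) scaler0.
  move=> k ki; rewrite mulr_sumr mulr_suml big1 // => l _.
  by rewrite -scalerAr -scalerAl EE eq_sym (negPf ki) mul0r scaler0.
(* A vanishing [E i j] would kill every [E k k = E k i * E i j * E j k], hence their sum 1. *)
have E0 i j : E i j <> 0.
  move=> Eij; have /eqP := oner_neq0 T; case.
  rewrite -sE big1 // => k _; have := EE k j j k; rewrite eqxx => <-.
  by have := EE k i i j; rewrite eqxx Eij mulr0 => <-; rewrite mul0r.
apply: iso_sym; apply: (iso_of_inj (f := f)).
- split=> [c x y|x y|].
  + rewrite /f scaler_sumr -big_split; apply: eq_bigr => i _ /=.
    rewrite scaler_sumr -big_split; apply: eq_bigr => j _ /=.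
    by rewrite !mxE scalerDl scalerA.
  + rewrite /f mulr_suml; apply: eq_bigr => i _; rewrite mulr_suml.
    transitivity (\sum_l \sum_j (x i j * y j l) *: E i l).
      by apply: eq_bigr => l _; rewrite -scaler_suml !mxE.
    rewrite exchange_big; apply: eq_bigr => j _ /=.
    rewrite mulr_sumr [RHS](bigD1 j) //= [X in _ = _ + X]big1 ?addr0.
      rewrite mulr_sumr; apply: eq_bigr => l _.
      by rewrite -scalerAl -scalerAr EE eqxx scalerA.
    move=> k kj; rewrite mulr_sumr big1 // => l _.
    by rewrite -scalerAl -scalerAr EE eq_sym (negPf kj) !scaler0.
  + rewrite -sE; apply: eq_bigr => i _; rewrite (bigD1 i) //= big1 ?addr0.
      by rewrite !mxE eqxx scale1r.
    by move=> j ji; rewrite !mxE eq_sym (negPf ji) scale0r.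
- move=> M fM; apply/matrixP => i j; rewrite mxE; have := fE i j M.
  by rewrite fM mulr0 mul0r => /esym/eqP; rewrite scaler_eq0 => /orP[/eqP//|/eqP/E0].
by rewrite dT dim_matrix.
Qed.

Lemma sum_delta_mx q : \sum_(i < q.+1) delta_mx i i = 1 :> 'M[K]_q.+1.
Proof.
rewrite -[RHS]/(1%:M) [1%:M]matrix_sum_delta; apply: eq_bigr => i _.
rewrite (bigD1 i) //= big1 ?addr0 => [|j ji]; first by rewrite mxE eqxx scale1r.
by rewrite mxE eq_sym (negPf ji) scale0r.
Qed.

(** Kronecker products of matrix units are matrix units indexed by pairs, which [enum_val]
    numbers. *)
Lemma tensor_matrix r s :
  exists q, iso (tensor 'M[K]_r.+1 'M[K]_s.+1) 'M[K]_q.+1.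
Proof.
pose q := #|{: 'I_r.+1 * 'I_s.+1}|.-1.
have qE : q.+1 = #|{: 'I_r.+1 * 'I_s.+1}| by rewrite /q card_prod !card_ord.
exists q; pose h (i : 'I_q.+1) : 'I_r.+1 * 'I_s.+1 := enum_val (cast_ord qE i).
have hI : injective h by move=> i j /enum_val_inj/cast_ord_inj.
pose E i j : tensor 'M[K]_r.+1 'M[K]_s.+1 :=
  tpure (delta_mx (h i).1 (h j).1) (delta_mx (h i).2 (h j).2).
apply: (matrix_units_iso (E := E)) => [i j k l||].
- rewrite /E tpureM -!mulmxE !mul_delta_mx_cond.
  have [->|jk] := eqVneq j k; first by rewrite !eqxx !mulr1n.
  have : h j != h k by rewrite (inj_eq hI).
  rewrite -pair_eqE /pair_eq /= negb_and => /orP[]/negPf->; rewrite mulr0n.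
    by rewrite -[X in tpure X _](scale0r 0) tpureZl scale0r.
  by rewrite -[X in tpure _ X](scale0r 0) tpureZr scale0r.
- transitivity (\sum_i \sum_j tpure (delta_mx i i) (delta_mx j j)
       : tensor 'M[K]_r.+1 'M[K]_s.+1).
    rewrite pair_bigA /= (reindex h) //=.
    exists (fun x => cast_ord (esym qE) (enum_rank x)).
      by move=> i _; rewrite /h enum_valK cast_ordK.
    by move=> x _; rewrite /h cast_ordKV enum_rankK.
  rewrite -tpure11 -[X in tpure X]sum_delta_mx -[X in tpure _ X]sum_delta_mx.
  have t0l b : @tpure K 'M[K]_r.+1 'M[K]_s.+1 0 b = 0.
    by rewrite -(scale0r 0) tpureZl scale0r.
  have t0r b : @tpure K 'M[K]_r.+1 'M[K]_s.+1 b 0 = 0.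
    by rewrite -(scale0r 0) tpureZr scale0r.
  rewrite (big_morph _ (tpureDl _) (t0l _)); apply: eq_bigr => i _.
  by rewrite (big_morph _ (tpureDr _) (t0r _)).
by rewrite dim_tensor !dim_matrix qE card_prod !card_ord mulnACA.
Qed.

End Isomorphism.

(** * Brauer equivalence and its compatibility with tensor products *)

Section BrauerEquivalence.

Variable K : fieldType.
Implicit Types A B C M N T : falgType K.

Lemma tensorACA A B C T :
  iso (tensor (tensor A B) (tensor C T)) (tensor (tensor A C) (tensor B T)).
Proof.
apply: iso_trans (iso_sym (tensorA _ _ _)) _.
apply: iso_trans (tensorA _ _ _).
apply: tensor_congr (iso_refl _) _.
apply: iso_trans (tensorA _ _ _) _; apply: iso_trans (iso_sym (tensorA _ _ _)).
exact: tensor_congr (tensorC _ _) (iso_refl _).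
Qed.

Definition is_matrix_algebra M : Prop := exists q, iso M 'M[K]_q.+1.

Lemma is_matrix_algebra_matrix q : is_matrix_algebra 'M[K]_q.+1.
Proof. by exists q; exact: iso_refl. Qed.

Lemma is_matrix_algebra_base : is_matrix_algebra (K^o : falgType K).
Proof.
exists 0%N; apply: (@matrix_units_iso _ 0 (K^o : falgType K) (fun _ _ => 1)) => //.
  by move=> i j k l; rewrite !ord1 eqxx mulr1.
by rewrite big_ord1.
Qed.

Lemma is_matrix_algebra_tensor M N :
  is_matrix_algebra M -> is_matrix_algebra N -> is_matrix_algebra (tensor M N).
Proof.
case=> q isoM [r isoN]; have [t isoT] := tensor_matrix K q r.
by exists t; exact: iso_trans (tensor_congr isoM isoN) isoT.
Qed.

(** Allowing any algebra isomorphic to a matrix algebra, and not only a matrix algebra of given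
    size, lets tensor products of such algebras serve as witnesses directly. *)
Definition brauer_equiv A B : Prop :=
  exists M N, [/\ is_matrix_algebra M, is_matrix_algebra N &
                  iso (tensor A M) (tensor B N)].

Lemma brauer_eqP A B : brauer_eq A B <-> brauer_equiv A B.
Proof.
split=> [[r [s [C [/is_tensorP AC /is_tensorP BC]]]]|].
  exists 'M[K]_r.+1, 'M[K]_s.+1; split; try exact: is_matrix_algebra_matrix.
  exact: iso_trans AC (iso_sym BC).
case=> M [N [[r isoM] [s isoN] AB]]; exists r, s, (tensor A 'M[K]_r.+1).
split; apply/is_tensorP; first exact: iso_refl.
apply: iso_trans (tensor_congr (iso_refl _) (iso_sym isoN)) _.
apply: iso_trans (iso_sym AB) _.
exact: tensor_congr (iso_refl _) isoM.
Qed.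

Lemma iso_brauer A B : iso A B -> brauer_equiv A B.
Proof.
move=> AB; exists (K^o : falgType K), (K^o : falgType K).
by split; [exact: is_matrix_algebra_base..|exact: tensor_congr AB (iso_refl _)].
Qed.

Lemma brauer_refl A : brauer_equiv A A.
Proof. exact: iso_brauer (iso_refl A). Qed.

Lemma brauer_sym A B : brauer_equiv A B -> brauer_equiv B A.
Proof. by case=> M [N [mM mN /iso_sym AB]]; exists N, M. Qed.

Lemma brauer_trans A B C :
  brauer_equiv A B -> brauer_equiv B C -> brauer_equiv A C.
Proof.
case=> M [N [mM mN AB]] [M' [N' [mM' mN' BC]]].
(* With juxtaposition for tensor products, the chain is A(MM') = (AM)M' = (BN)M' = (BM')N = (CN')N =
   C(N'N). *)
exists (tensor M M'), (tensor N' N).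
split; [exact: is_matrix_algebra_tensor..|].
apply: iso_trans (tensorA _ _ _) _.
apply: iso_trans (tensor_congr AB (iso_refl _)) _.
apply: iso_trans (iso_sym (tensorA _ _ _)) _.
apply: iso_trans (tensor_congr (iso_refl _) (tensorC _ _)) _.
apply: iso_trans (tensorA _ _ _) _.
apply: iso_trans (tensor_congr BC (iso_refl _)) _.
exact: iso_sym (tensorA _ _ _).
Qed.

Lemma brauer_tensor A A' B B' : brauer_equiv A A' -> brauer_equiv B B' ->
  brauer_equiv (tensor A B) (tensor A' B').
Proof.
case=> M [N [mM mN AA]] [M' [N' [mM' mN' BB]]].
exists (tensor M M'), (tensor N N').
split; [exact: is_matrix_algebra_tensor..|].
apply: iso_trans (tensorACA _ _ _ _) _.
apply: iso_trans (tensor_congr AA BB) _.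
exact: tensorACA.
Qed.

Lemma matrix_brauer M : is_matrix_algebra M -> brauer_equiv M (K^o : falgType K).
Proof.
move=> mM; exists (K^o : falgType K), M; split=> //.
  exact: is_matrix_algebra_base.
exact: tensorC.
Qed.

Lemma brauer_tensor0 A M :
  brauer_equiv M (K^o : falgType K) -> brauer_equiv (tensor A M) A.
Proof.
move=> M0; apply: brauer_trans (iso_brauer (tensor1 A)).
exact: brauer_tensor (brauer_refl _) M0.
Qed.

End BrauerEquivalence.

(** * The defining relations of a symbol algebra and linear independence of the monomials *)

Section SymbolAlgebras.

Variables (K : fieldType) (p : nat).
Hypothesis pcharK : p \in [pchar K].
Implicit Types (A B S T : falgType K) (a b c : K).

Let p_pr : prime p := pcharf_prime pcharK.
Let p_gt0 : (0 < p)%N := prime_gt0 p_pr.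

(** Only the relations are asked for, in an arbitrary algebra; for nonzero [b] they force the
    monomials to be independent, see [symbol_comb_inj]. *)
Definition symbol_pair a b T (x y : T) : Prop :=
  [/\ x ^+ p - x = a%:A, y ^+ p = b%:A & y * x = (x + 1) * y].

Lemma natr_neq0 k : (0 < k < p)%N -> k%:R != 0 :> K.
Proof.
by case/andP=> k0 kp; rewrite -(dvdn_pcharf pcharK) gtnNdvd.
Qed.

Lemma natr_inj_p i j : (i < p)%N -> (j < p)%N -> i%:R = j%:R :> K -> i = j.
Proof.
wlog lij : i j / (i <= j)%N => [hw|] ip jp ij.
  by case/orP: (leq_total i j) => h; [exact: hw|apply/esym/hw].
move: lij; rewrite leq_eqVlt => /orP[/eqP//|lij].
have : (j - i)%:R != 0 :> K.
  by rewrite natr_neq0 // subn_gt0 lij (leq_ltn_trans (leq_subr _ _) jp).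
by rewrite natrB ?(ltnW lij) // ij subrr eqxx.
Qed.

Lemma pcharT T : p \in [pchar T].
Proof. by rewrite pchar_lalg. Qed.

Section Pair.

Variables (a b : K) (T : falgType K) (x y : T).
Hypothesis xy : symbol_pair a b x y.

Lemma symbol_yXx j : y ^+ j * x = (x + j%:R) * y ^+ j.
Proof.
case: xy => _ _ yx; elim: j => [|j IHj]; first by rewrite !expr0 mul1r addr0 mulr1.
rewrite exprS -mulrA IHj mulrA mulrDr yx (commr_nat y j) -mulrDl -mulrA -exprS.
by rewrite -addrA -[1 + _]/(1%:R + _) -natrD add1n.
Qed.

Lemma symbol_yXxX j k : y ^+ j * x ^+ k = (x + j%:R) ^+ k * y ^+ j.
Proof.
elim: k => [|k IHk]; first by rewrite !expr0 mul1r mulr1.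
by rewrite exprSr mulrA IHk -mulrA symbol_yXx mulrA -exprSr.
Qed.

Hypothesis b0 : b != 0.

Lemma symbol_y_unit : y \is a GRing.unit.
Proof.
case: xy => _ yp _; apply/unitrP; exists (b^-1 *: y ^+ p.-1).
rewrite -scalerAl -scalerAr -exprS -exprSr prednK // yp scalerA mulVf //.
by rewrite scale1r.
Qed.

(* The commutator with x multiplies z j * y ^+ j by j, so that these terms are
   eigenvectors for distinct eigenvalues. *)
Lemma symbol_y_free (z : 'I_p -> T) :
  (forall j, z j * x = x * z j) -> \sum_j z j * y ^+ j = 0 ->
  forall j, z j = 0.
Proof.
move=> zx z0 l.
have zy j : z j * y ^+ j * x = x * (z j * y ^+ j) + j%:R *: (z j * y ^+ j).
  by rewrite -mulrA symbol_yXx mulrA mulrDr zx mulrDl mulr_natr mulrnAl scaler_nat mulrA.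
(* The operator sending [w] to [w * x - x * w - i%:R *: w] multiplies the term of index [j] by
   [j - i]. Composing it over all [i] other than [l] leaves a nonzero multiple of the term of index
   [l]. *)
have step (s : seq 'I_p) :
    \sum_(j < p) (\prod_(i <- s) (j%:R - i%:R) : K) *: (z j * y ^+ j) = 0.
  elim: s => [|i s IHs].
    by rewrite -[RHS]z0; apply: eq_bigr => j _; rewrite big_nil scale1r.
  pose w := \sum_(j < p) (\prod_(i <- s) (j%:R - i%:R) : K) *: (z j * y ^+ j).
  have : w * x - x * w - i%:R *: w = 0 by rewrite /w IHs mulr0 mul0r scaler0 !subr0.
  move=> h; rewrite -[RHS]h /w mulr_suml mulr_sumr scaler_sumr -!sumrB.
  apply: eq_bigr => j _; rewrite big_cons -scalerAl -scalerAr zy.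
  rewrite scalerDr [X in _ = X - _ - _]addrC addrK !scalerA -scalerBl; congr (_ *: _).
  by rewrite mulrBl [X in _ = X - _]mulrC.
have := step [seq i <- enum 'I_p | i != l].
rewrite (bigD1 l) //= [X in _ + X]big1 ?addr0 => [|j jl]; last first.
  rewrite (big_rem j) /=; first by rewrite subrr mul0r scale0r.
  by rewrite mem_filter jl mem_enum.
move/eqP; rewrite scaler_eq0 => /orP[/eqP|/eqP].
  move/eqP; rewrite prodf_seq_eq0 => /hasP[i].
  rewrite mem_filter => /andP[il _] /=; rewrite subr_eq0 => /eqP/natr_inj_p.
  by move/(_ (ltn_ord _) (ltn_ord _)) => h; case/eqP: il; apply/val_inj.
by move=> h; apply: (mulIr (unitrX l symbol_y_unit)); rewrite mul0r.
Qed.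

(* Conjugation by y turns the sum into its translate by 1; the difference has
   smaller degree. *)
Lemma symbol_x_free d (c : nat -> T) : (d <= p)%N ->
  (forall i, c i * y = y * c i) -> \sum_(i < d) x ^+ i * c i = 0 ->
  forall i, (i < d)%N -> c i = 0.
Proof.
elim: d c => // d IHd c dp cy c0.
suff cd : c d = 0.
  move: c0; rewrite big_ord_recr /= cd mulr0 addr0 => c0 i.
  rewrite ltnS leq_eqVlt => /orP[/eqP->//|]; exact: IHd (ltnW dp) cy c0 i.
case: d => [|d] in IHd dp c0 *; first by rewrite big_ord1 expr0 mul1r in c0.
pose e i k := (if (k < i)%N then 'C(i, k) else 0)%N.
pose c' k := \sum_(i < d.+2) c i *+ e i k.
have c'0 : \sum_(k < d.+1) x ^+ k * c' k = 0.
  have : y * (\sum_(i < d.+2) x ^+ i * c i) - (\sum_(i < d.+2) x ^+ i * c i) * y = 0.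
    by rewrite c0 mulr0 mul0r subr0.
  rewrite mulr_sumr mulr_suml -sumrB => h.
  apply: (mulIr symbol_y_unit); rewrite mul0r -[RHS]h {h}.
  under eq_bigr do rewrite mulr_sumr; rewrite exchange_big mulr_suml.
  apply: eq_bigr => i _ /=; have := symbol_yXxX 1 i; rewrite expr1 => yx.
  have -> : y * (x ^+ i * c i) = (x + 1) ^+ i * c i * y.
    by rewrite mulrA yx -!mulrA cy.
  rewrite -mulrBl -mulrBl; congr (_ * _).
  have -> : (x + 1) ^+ i - x ^+ i = \sum_(k < i) x ^+ k *+ 'C(i, k).
    by rewrite exprD1n big_ord_recr /= binn mulr1n addrK.
  rewrite (big_ord_widen_cond d.+1 xpredT (fun k => x ^+ k *+ 'C(i, k))) -1?ltnS //.
  rewrite mulr_suml [RHS]big_mkcond; apply: eq_bigr => k _ /=.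
  by rewrite /e; case: ltnP => _; rewrite ?mulr0n ?mulr0 // mulrnAl mulrnAr.
have cy' k : c' k * y = y * c' k.
  rewrite /c' mulr_suml mulr_sumr; apply: eq_bigr => i _.
  by rewrite mulrnAl mulrnAr cy.
(* The top coefficient [c' d] is [d + 1] times [c (d + 1)], and [d + 1] is nonzero in [K] because it
   is less than [p]. *)
have := IHd c' (ltnW dp) cy' c'0 d (ltnSn d).
rewrite /c' (bigD1 ord_max) //= big1 => [|i]; last first.
  rewrite -val_eqE /= => id; rewrite /e ltnNge -ltnS ltn_neqAle id -ltnS ltn_ord.
  by rewrite mulr0n.
rewrite addr0 /e ltnSn binSn -scaler_nat => /eqP; rewrite scaler_eq0 => /orP[|/eqP//].
by move=> h; have := natr_neq0 (k := d.+1) dp; rewrite h.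
Qed.

End Pair.
End SymbolAlgebras.

(** * Structure constants and the universal property of symbol algebras *)

Section SymbolPresentation.

Variables (K : fieldType) (p : nat).
Hypothesis pcharK : p \in [pchar K].
Implicit Types (A B S T : falgType K) (a b : K).

Let p_pr : prime p := pcharf_prime pcharK.
Let p_gt0 : (0 < p)%N := prime_gt0 p_pr.
Let p_gt1 : (1 < p)%N := prime_gt1 p_pr.

(** The coefficients range over the centralizer of [x] and [y] and not only over [K]: this is what
    gives injectivity on a tensor product with [a, b) in [symbol_tensor_inj]. *)
Lemma symbol_free a b T (x y : T) (c : 'I_p -> 'I_p -> T) :
  symbol_pair p a b x y -> b != 0 ->
  (forall i j, c i j * x = x * c i j) -> (forall i j, c i j * y = y * c i j) ->
  \sum_(i < p) \sum_(j < p) x ^+ i * y ^+ j * c i j = 0 -> forall i j, c i j = 0.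
Proof.
move=> xy b0 cx cy c0 i j.
have cyX k l m : c k l * y ^+ m = y ^+ m * c k l.
  by apply: commrX; rewrite /GRing.comm cy.
have cxX k l m : c k l * x ^+ m = x ^+ m * c k l.
  by apply: commrX; rewrite /GRing.comm cx.
pose d j (i : nat) := if insub i is Some i' then c i' j else 0.
have dE j' (k : 'I_p) : d j' k = c k j' by rewrite /d valK.
rewrite -dE; apply: (symbol_x_free pcharK xy b0 (leqnn p)) => // [k|].
  by rewrite /d; case: insub => [k'|]; rewrite ?mulr0 ?mul0r.
apply: (symbol_y_free pcharK xy b0 (z := fun j => \sum_(i < p) x ^+ i * d j i)).
  move=> k; rewrite mulr_suml mulr_sumr; apply: eq_bigr => l _.
  by rewrite dE mulrA -exprS exprSr -!mulrA cx.
rewrite -[RHS]c0 exchange_big; apply: eq_bigr => k _; rewrite mulr_suml.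
by apply: eq_bigr => l _; rewrite dE -!mulrA cyX.
Qed.

Definition symbol_comb T (x y : T) (c : 'M[K]_p) : T :=
  \sum_(i < p) \sum_(j < p) c i j *: (x ^+ i * y ^+ j).

Lemma symbol_combP T (x y : T) : linear (symbol_comb x y).
Proof.
move=> k c d; rewrite /symbol_comb scaler_sumr -big_split; apply: eq_bigr => i _ /=.
rewrite scaler_sumr -big_split; apply: eq_bigr => j _ /=.
by rewrite !mxE scalerDl scalerA.
Qed.

Lemma symbol_combD T (x y : T) : {morph symbol_comb x y : c d / c + d}.
Proof. by move=> c d; have := symbol_combP x y 1 c d; rewrite !scale1r. Qed.

Lemma symbol_comb0 T (x y : T) : symbol_comb x y 0 = 0.
Proof.
by rewrite /symbol_comb big1 // => i _; rewrite big1 // => j _; rewrite mxE scale0r.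
Qed.

Lemma symbol_combZ T (x y : T) k c : symbol_comb x y (k *: c) = k *: symbol_comb x y c.
Proof. by have := symbol_combP x y k c 0; rewrite !addr0 symbol_comb0 addr0. Qed.

Lemma symbol_comb_delta T (x y : T) i j :
  symbol_comb x y (delta_mx i j) = x ^+ i * y ^+ j.
Proof.
rewrite /symbol_comb (bigD1 i) //= [X in _ + X]big1 ?addr0 => [|k ki].
  rewrite (bigD1 j) //= [X in _ + X]big1 ?addr0 => [|k kj].
    by rewrite mxE !eqxx scale1r.
  by rewrite mxE (negPf kj) andbF scale0r.
by rewrite big1 // => l _; rewrite mxE (negPf ki) scale0r.
Qed.

Lemma symbol_comb_inj a b T (x y : T) c : symbol_pair p a b x y -> b != 0 ->
  symbol_comb x y c = 0 -> c = 0.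
Proof.
move=> xy b0 c0; apply/matrixP => i j; rewrite mxE.
have := @symbol_free a b T x y (fun i j => (c i j)%:A) xy b0.
move=> /(_ _ _ _ i j) h; apply/eqP; rewrite -[_ == 0]orbF -(negbTE (oner_neq0 T)).
rewrite -scaler_eq0; apply/eqP/h.
- by move=> k l; rewrite mulr_algl mulr_algr.
- by move=> k l; rewrite mulr_algl mulr_algr.
rewrite -[RHS]c0; apply: eq_bigr => k _; apply: eq_bigr => l _.
by rewrite mulr_algr.
Qed.

(* w is a word in the generators whose value can be expressed by the same
   combination of the monomials x^i y^j, i, j < p, in all algebras. *)
Definition reducible a b (w : forall T, T -> T -> T) : Prop :=
  exists e, forall T (x y : T), symbol_pair p a b x y -> w T x y = symbol_comb x y e.

Lemma reducible_ext a b (w w' : forall T, T -> T -> T) :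
  (forall T (x y : T), symbol_pair p a b x y -> w' T x y = w T x y) ->
  reducible a b w -> reducible a b w'.
Proof. by move=> ww [e we]; exists e => T x y xy; rewrite ww ?we. Qed.

Lemma reducibleD a b (w w' : forall T, T -> T -> T) :
  reducible a b w -> reducible a b w' ->
  reducible a b (fun T x y => w T x y + w' T x y).
Proof.
by case=> e we [e' we']; exists (e + e') => T x y xy; rewrite symbol_combD we ?we'.
Qed.

Lemma reducibleZ a b k (w : forall T, T -> T -> T) :
  reducible a b w -> reducible a b (fun T x y => k *: w T x y).
Proof. by case=> e we; exists (k *: e) => T x y xy; rewrite symbol_combZ we. Qed.

Lemma reducible_sum a b (I : finType) (w : I -> forall T, T -> T -> T) :
  (forall i, reducible a b (w i)) ->
  reducible a b (fun T x y => \sum_i w i T x y).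
Proof.
move=> rw; elim: (index_enum I) => [|i s IHs].
  by exists 0 => T x y _; rewrite big_nil symbol_comb0.
apply: reducible_ext (reducibleD (rw i) IHs) => T x y _.
by rewrite big_cons.
Qed.

Lemma reducible_mon a b k l : reducible a b (fun T x y => x ^+ k * y ^+ l).
Proof.
elim/ltn_ind: l k => l IHl k; have [lp|pl] := ltnP l p; last first.
  have lt : (l - p < l)%N by rewrite ltn_subrL p_gt0 (leq_trans p_gt0).
  apply: reducible_ext (reducibleZ b (IHl _ lt k)) => T x y [_ yp _].
  by rewrite -{1}(subnK pl) exprD yp mulr_algr scalerAr.
elim/ltn_ind: k => k IHk; have [kp|pk] := ltnP k p.
  by exists (delta_mx (Ordinal kp) (Ordinal lp)) => T x y _; rewrite symbol_comb_delta.
have lt : (k - p < k)%N by rewrite ltn_subrL p_gt0 (leq_trans p_gt0).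
have lt1 : ((k - p).+1 < k)%N by rewrite -(subnK pk) addnK -addn1 ltn_add2l.
apply: reducible_ext (reducibleD (IHk _ lt1) (reducibleZ a (IHk _ lt))) => T x y [xp _ _].
have xpE : x ^+ p = x + a%:A by rewrite -xp addrC subrK.
rewrite -{1}(subnK pk) exprD xpE mulrDr mulrDl mulr_algr -exprSr.
by rewrite scalerAl.
Qed.

Lemma reducible_xj a b i k (j : nat) l :
  reducible a b (fun T x y => x ^+ i * (x + j%:R) ^+ k * y ^+ l).
Proof.
elim: k i => [|k IHk] i.
  apply: reducible_ext (reducible_mon a b i l) => T x y _.
  by rewrite expr0 mulr1.
apply: reducible_ext (reducibleD (IHk i.+1) (reducibleZ j%:R (IHk i))) => T x y _.
rewrite exprS mulrDl mulrDr mulrDl mulrA -exprSr; congr (_ + _).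
by rewrite mulr_natl mulrnAr mulrnAl scaler_nat.
Qed.

(** This is the multiplication table of [a, b): the coefficients of the product depend on [a], [b],
    [c], [d] but not on the algebra. It makes the map of [symbol_univ] multiplicative and the span
    of the monomials a subalgebra in [exists_symbol_algebra]. *)
Lemma reducible_combM a b c d :
  reducible a b (fun T x y => symbol_comb x y c * symbol_comb x y d).
Proof.
apply: (@reducible_ext a b (fun T x y => \sum_(i < p) \sum_(j < p) \sum_(k < p) \sum_(l < p)
  (c i j * d k l) *: (x ^+ i * y ^+ j * (x ^+ k * y ^+ l)))).
  move=> T x y _; rewrite {1}/symbol_comb mulr_suml; apply: eq_bigr => i _.
  rewrite mulr_suml; apply: eq_bigr => j _; rewrite mulr_sumr; apply: eq_bigr => k _.
  rewrite mulr_sumr; apply: eq_bigr => l _.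
  by rewrite -scalerAl -scalerAr scalerA.
do 4!(apply: reducible_sum => ?); apply: reducibleZ.
match goal with |- reducible _ _ (fun T x y => x ^+ ?i * y ^+ ?j * (x ^+ ?k * y ^+ ?l)) =>
  apply: reducible_ext (reducible_xj a b i k j (j + l)) end.
move=> T x y xy; rewrite mulrA -(mulrA (x ^+ _)) (symbol_yXxX xy).
by rewrite exprD !mulrA.
Qed.

(** For nonzero [b] the dimension replaces the basis condition of [is_symbol_algebra], since the
    monomials are then automatically independent. *)
Definition symbol_algebra a b S : Prop :=
  dim S = (p * p)%N /\ exists x y : S, symbol_pair p a b x y.

Lemma symbol_comb_surj a b S (x y : S) : b != 0 -> dim S = (p * p)%N ->
  symbol_pair p a b x y -> forall s, exists c, symbol_comb x y c = s.
Proof.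
move=> b0 dS xy s.
pose F : {linear 'M[K]_p -> S} :=
  HB.pack (symbol_comb x y)
    (GRing.isLinear.Build K 'M[K]_p S _ _ (symbol_combP x y)).
have kF : lker (linfun F) == 0%VS.
  rewrite -subv0; apply/subvP => c; rewrite memv_ker lfunE /= => /eqP.
  by move/(symbol_comb_inj xy b0) => ->; rewrite mem0v.
have : s \in limg (linfun F).
  suff -> : limg (linfun F) = fullv by rewrite memvf.
  have dF : \dim (limg (linfun F)) = (p * p)%N.
    by rewrite limg_dim_eq ?(eqP kF) ?capv0 // dimvf dim_matrix.
  by apply/eqP; rewrite eqEdim subvf dimvf dS dF leqnn.
by case/memv_imgP => c _ ->; exists c; rewrite lfunE.
Qed.

Lemma is_symbol_algebraP a b S : b != 0 ->
  is_symbol_algebra p a b S <-> symbol_algebra a b S.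
Proof.
move=> b0; split=> [[x [y [h1 h2 h3]]]|[dS [x [y xy]]]].
  set s := flatten _ => bas; split; last by exists x, y.
  by rewrite -dimvf (@size_basis _ _ _ _ (in_tuple s) bas) size_allpairs size_iota.
exists x, y; case: (xy) => h1 h2 h3; split=> //; set s := flatten _.
rewrite basisEdim dimvf dS size_allpairs size_iota leqnn andbT.
apply/subvP => z _; have [c <-] := symbol_comb_surj b0 dS xy z.
apply: memv_suml => i _; apply: memv_suml => j _; apply/memvZ/memv_span.
by apply/allpairsP; exists (val i, val j); rewrite !mem_iota /= !add0n !ltn_ord.
Qed.

(** Coordinates are read in [S] and evaluated in [T]; the result is multiplicative because both
    algebras share the structure constants of [reducible_combM]. *)
Lemma symbol_univ a b S (xS yS : S) T (x y : T) :
  b != 0 -> dim S = (p * p)%N -> symbol_pair p a b xS yS ->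
  symbol_pair p a b x y ->
  exists2 f : S -> T, algebra_morphism f & f xS = x /\ f yS = y.
Proof.
move=> b0 dS xyS xy; have surj := symbol_comb_surj b0 dS xyS.
have inj c d : symbol_comb xS yS c = symbol_comb xS yS d -> c = d.
  move=> cd; apply/eqP; rewrite -subr_eq0; apply/eqP/(symbol_comb_inj xyS b0).
  by rewrite -scaleN1r addrC symbol_combP cd scaleN1r addNr.
have surjb s : exists c, symbol_comb xS yS c == s by have [c <-] := surj s; exists c.
pose m s := xchoose (surjb s).
have mK s : symbol_comb xS yS (m s) = s by apply/eqP; exact: (xchooseP (surjb s)).
have Km c : m (symbol_comb xS yS c) = c by apply: inj; rewrite mK.
have mon i j : (i < p)%N -> (j < p)%N ->
    symbol_comb x y (m (xS ^+ i * yS ^+ j)) = x ^+ i * y ^+ j.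
  move=> ip jp; rewrite -(symbol_comb_delta _ _ (Ordinal ip) (Ordinal jp)) Km.
  by rewrite symbol_comb_delta.
exists (fun s => symbol_comb x y (m s)); first split.
- move=> c s t; rewrite -symbol_combP; congr symbol_comb.
  by apply: inj; rewrite symbol_combP !mK.
- move=> s t; have [e He] := reducible_combM a b (m s) (m t).
  rewrite He //; congr symbol_comb; apply: inj; rewrite mK -He //.
  by rewrite !mK.
- by have := mon 0%N 0%N p_gt0 p_gt0; rewrite !expr0 !mulr1.
have := mon 1%N 0%N p_gt1 p_gt0; have := mon 0%N 1%N p_gt0 p_gt1.
by rewrite !expr0 !expr1 !mulr1 !mul1r.
Qed.

Lemma symbol_pair_morph a b S T (f : S -> T) (x y : S) :
  algebra_morphism f -> symbol_pair p a b x y -> symbol_pair p a b (f x) (f y).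
Proof.
move=> /algebra_morphismP[F fF] [h1 h2 h3]; rewrite !fF.
have FA c : F c%:A = c%:A by rewrite linearZ rmorph1.
split.
- by have := congr1 F h1; rewrite rmorphB rmorphXn /= FA.
- by have := congr1 F h2; rewrite rmorphXn /= FA.
- by have := congr1 F h3; rewrite !rmorphM rmorphD rmorph1.
Qed.

(** A tensor is a combination of the monomials of [S] with coefficients in [B], and [g] sends these
    coefficients into the centralizer of [f x] and [f y], where [symbol_free] applies. *)
Lemma symbol_tensor_inj a b S B T (f : S -> T) (g : B -> T) :
  b != 0 -> symbol_algebra a b S ->
  algebra_morphism f -> algebra_morphism g ->
  (forall s t, f s * g t = g t * f s) -> (forall t, g t = 0 -> t = 0) ->
  forall z, tensor_map f g z = 0 -> z = 0.
Proof.
move=> b0 [dS [x [y xy]]] mf mg fg gi z.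
have [c ->] : exists c : 'I_p -> 'I_p -> B,
    z = \sum_(i < p) \sum_(j < p) tpure (x ^+ i * y ^+ j) (c i j).
  elim/tensor_ind: z => [z z' [c ->] [c' ->]|s t].
    exists (fun i j => c i j + c' i j); rewrite -big_split; apply: eq_bigr => i _ /=.
    by rewrite -big_split; apply: eq_bigr => j _ /=; rewrite tpureDr.
  have [c <-] := symbol_comb_surj b0 dS xy s; exists (fun i j => c i j *: t).
  have t0 : @tpure _ S B 0 t = 0 by rewrite -(scale0r 0) tpureZl scale0r.
  rewrite (big_morph _ (tpureDl t) t0); apply: eq_bigr => i _.
  rewrite (big_morph _ (tpureDl t) t0); apply: eq_bigr => j _.
  by rewrite tpureZl tpureZr.
have [F fF] := algebra_morphismP mf; have [G gG] := algebra_morphismP mg.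
have [H hH] := algebra_morphismP (tensor_map_morphism mf mg fg).
rewrite hH linear_sum => h; rewrite big1 // => i _; rewrite big1 // => j _.
suff -> : c i j = 0 by rewrite -(scale0r 0) tpureZr scale0r.
apply: gi; apply: (@symbol_free a b T (f x) (f y) (fun i j => g (c i j))) => //.
- exact: symbol_pair_morph mf xy.
rewrite -[RHS]h; apply: eq_bigr => k _; rewrite linear_sum; apply: eq_bigr => l _.
by rewrite -[RHS]hH tensor_mapE // !fF rmorphM !rmorphXn.
Qed.

End SymbolPresentation.

(** * Matrix models of [a, 1) and [0, b) *)

Section SplitSymbols.

Variables (K : fieldType) (p : nat).
Hypothesis pcharK : p \in [pchar K].
Implicit Types (A B S T : falgType K) (a b : K).

Let p_pr : prime p := pcharf_prime pcharK.
Let p_gt0 : (0 < p)%N := prime_gt0 p_pr.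
Let p_gt1 : (1 < p)%N := prime_gt1 p_pr.
Let pS : p.-1.+1 = p := prednK p_gt0.

Lemma exprB_pchar (R : comNzRingType) (x y : R) :
  p \in [pchar R] -> (x - y) ^+ p = x ^+ p - y ^+ p.
Proof. by move=> cR; have := rmorphB (pFrobenius_aut cR) x y. Qed.

Lemma mulmx_row_eq n (A B : 'M[K]_n) :
  (forall v : 'rV_n, v *m A = v *m B) -> A = B.
Proof. by move=> h; apply/row_matrixP => i; rewrite !rowE h. Qed.

(* The algebra [a, 1) acts on K[X] / (X^p - X - a): x is multiplication by X
   and y is the substitution X -> X - 1, as matrices act on row vectors from the
   right. *)
Lemma split_symbol_1 a :
  exists x y : 'M[K]_p.-1.+1, symbol_pair p a 1 x y.
Proof.
set n := p.-1.+1; pose Q : {poly K} := 'X^p - 'X - a%:P.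
have sQ : size Q = p.+1.
  rewrite /Q -addrA -opprD size_polyDl size_polyXn // size_polyN.
  by rewrite size_polyDl ?size_polyX // (leq_ltn_trans (size_polyC_leq1 _)).
have Q0 : Q != 0 by rewrite -size_poly_eq0 sQ.
have sm (f : {poly K}) : (size (f %% Q)%R <= n)%N by rewrite /n pS -ltnS -sQ ltn_modp.
pose sh : {poly K} := 'X - 1%:P.
have ssh : size sh = 2%N by rewrite size_XsubC.
(* In characteristic p, (X - 1)^p - (X - 1) = X^p - X, so the substitution descends to the quotient
   by [Q]. *)
have Qsh : Q \Po sh = Q.
  rewrite /Q !comp_polyB comp_Xn_poly comp_polyX comp_polyC.
  rewrite exprB_pchar ?pchar_poly // -polyC_exp expr1n.
  by rewrite opprB addrA subrK.
have sr (v : 'rV[K]_n) : (size (rVpoly v) <= n)%N by exact: size_poly.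
have srp (v : 'rV[K]_n) : (size (rVpoly v) <= p)%N by rewrite (leq_trans (sr v)) // /n pS.
pose fx0 (v : 'rV[K]_n) : 'rV[K]_n := poly_rV ((rVpoly v * 'X) %% Q).
have fx_lin : linear fx0.
  by move=> c u v; rewrite /fx0 !linearP /= mulrDl -scalerAl modpD modpZl linearP.
pose fy0 (v : 'rV[K]_n) : 'rV[K]_n := poly_rV (rVpoly v \Po sh).
have fy_lin : linear fy0.
  by move=> c u v; rewrite /fy0 !linearP.
pose fx : {linear 'rV[K]_n -> 'rV[K]_n} :=
  HB.pack fx0 (GRing.isLinear.Build K 'rV[K]_n 'rV[K]_n _ fx0 fx_lin).
pose fy : {linear 'rV[K]_n -> 'rV[K]_n} :=
  HB.pack fy0 (GRing.isLinear.Build K 'rV[K]_n 'rV[K]_n _ fy0 fy_lin).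
pose x : 'M[K]_n := lin1_mx fx; pose y : 'M[K]_n := lin1_mx fy.
have vx v : rVpoly (v *m x) = (rVpoly v * 'X) %% Q.
  by rewrite mul_rV_lin1 /= /fx0 /fy0 poly_rV_K.
have vy v : rVpoly (v *m y) = rVpoly v \Po sh.
  by rewrite mul_rV_lin1 /= /fx0 /fy0 poly_rV_K // size_comp_poly2.
have vxX v k : rVpoly (v *m (x ^+ k)) = (rVpoly v * 'X^k) %% Q.
  elim: k => [|k IHk].
    by rewrite !expr0 mulmx1 mulr1 modp_small // sQ ltnS srp.
  by rewrite exprSr -mulmxE mulmxA vx IHk mulrC modp_mul mulrC -mulrA -exprSr.
have vyX v k : rVpoly (v *m (y ^+ k)) = rVpoly v \Po ('X - (k%:R)%:P).
  elim: k => [|k IHk].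
    by rewrite !expr0 mulmx1 mulr0n subr0 comp_polyXr.
  rewrite exprSr -mulmxE mulmxA vy IHk -comp_polyA /sh comp_polyB comp_polyX comp_polyC.
  by rewrite -addrA -opprD -polyCD nat1r.
exists x, y; split; apply: mulmx_row_eq => v; apply: (can_inj rVpolyK).
- rewrite mulmxBr linearB /= vxX vx -modpN -modpD -mulrN -mulrDr.
  have -> : 'X^p - 'X = Q + a%:P by rewrite subrK.
  rewrite mulrDr modpD modp_mull add0r mulrC mul_polyC modpZl modp_small ?sQ ?ltnS ?srp //.
  by rewrite -scalemxAr mulmx1 linearZ.
- rewrite vyX (pcharf0 pcharK) subr0 comp_polyXr.
  by rewrite scale1r mulmx1.
have modsh (f : {poly K}) : (f %% Q) \Po sh = (f \Po sh) %% Q.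
  apply: (@modpP _ _ ((f %/ Q) \Po sh)).
    by rewrite {1}(divp_eq f Q) comp_polyD comp_polyM Qsh.
  by rewrite size_comp_poly2 // ltn_modp.
rewrite -!mulmxE !mulmxA vx vy vy mulmxDr mulmx1 linearD /= vx comp_polyD modsh.
rewrite comp_polyM comp_polyX /sh mulrBr mulr1 modpD modpN -/sh.
by rewrite [X in _ = _ - X + _]modp_small ?subrK // sQ ltnS size_comp_poly2 // srp.
Qed.

(** Here [x] is diagonal with eigenvalues the elements 0, ..., p - 1 of the prime field, which are
    the roots of X^p - X, and [y] shifts each eigenvector to the next one, with the factor [b] when
    it wraps around. *)
Lemma split_symbol_0 b : exists x y : 'M[K]_p.-1.+1, symbol_pair p 0 b x y.
Proof.
set n := p.-1.+1; have nE : n = p by rewrite /n pS.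
pose x : 'M[K]_n := \matrix_(i, j) (if i == j then i%:R else 0).
pose y : 'M[K]_n :=
  \matrix_(i < n) (if (i.+1 < n)%N then delta_mx 0 (inord i.+1) else b *: delta_mx 0 0).
pose e (i : nat) : 'rV[K]_n := delta_mx 0 (inord i).
have ex i : (i < n)%N -> e i *m x = i%:R *: e i.
  move=> ni; rewrite -rowE; apply/rowP => j; rewrite !mxE eqxx /= inordK //.
  by rewrite [j == _]eq_sym; case: eqP; rewrite ?mulr1 ?mulr0.
have ey i : (i.+1 < n)%N -> e i *m y = e i.+1.
  by move=> ni; rewrite -rowE rowK inordK ?ni // ltnW.
have eyn : e p.-1 *m y = b *: e 0%N.
  rewrite -rowE rowK inordK // ltnn; congr (_ *: delta_mx _ _).
  by apply/val_inj; rewrite /= inordK.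
have eyk i k : (i + k < n)%N -> e i *m y ^+ k = e (i + k)%N.
  elim: k => [|k IHk] ik; first by rewrite expr0 mulmx1 addn0.
  rewrite addnS in ik; rewrite exprSr -mulmxE mulmxA IHk; last exact: ltnW.
  by rewrite ey // addnS.
have eI (A B : 'M[K]_n) : (forall i, (i < n)%N -> e i *m A = e i *m B) -> A = B.
  move=> h; apply/row_matrixP => i; rewrite !rowE.
  by have := h i (ltn_ord i); rewrite /e inord_val.
have exk i k : (i < n)%N -> e i *m x ^+ k = i%:R ^+ k *: e i.
  move=> ni; elim: k => [|k IHk]; first by rewrite !expr0 mulmx1 scale1r.
  by rewrite exprSr -mulmxE mulmxA IHk -scalemxAl ex // scalerA -exprSr.
exists x, y; split; apply: eI => i ni.
- rewrite mulmxBr exk // ex // scale0r mulmx0.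
  by rewrite -(pFrobenius_autE pcharK) pFrobenius_aut_nat subrr.
- have -> : y ^+ p = y ^+ (p.-1 - i + 1 + i).
    by congr (_ ^+ _); rewrite addn1 addSn subnK ?pS // -ltnS.
  rewrite !exprD expr1 -!mulmxE !mulmxA eyk subnKC // eyn -scalemxAl eyk ?add0n //.
  by rewrite -scalemxAr mulmx1.
rewrite -!mulmxE !mulmxA mulmxDr mulmx1 ex // -{3}[e i]scale1r -scalerDl -scalemxAl natr1.
have [ni1|] := ltnP i.+1 n; first by rewrite ey // ex.
move=> ni1; have -> : i = p.-1 by apply/eqP; rewrite eqn_leq -ltnS ni -ltnS.
have p0 : p.-1.+1%:R = 0 :> K by rewrite pS (pcharf0 pcharK).
by rewrite eyn p0 scale0r -scalemxAl ex // scale0r scaler0.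
Qed.

End SplitSymbols.

(** * Existence of symbol algebras and the relations between their classes *)

Section SymbolRelations.

Variables (K : fieldType) (p : nat).
Hypothesis pcharK : p \in [pchar K].
Implicit Types (A B S T : falgType K) (a b : K).

Let p_pr : prime p := pcharf_prime pcharK.
Let p_gt0 : (0 < p)%N := prime_gt0 p_pr.
Let p_gt1 : (1 < p)%N := prime_gt1 p_pr.

Local Notation pair := (symbol_pair p).
Local Notation symb := (symbol_algebra p).

Lemma symbol_comb_morph S T (f : S -> T) x y (c : 'M_p) :
  algebra_morphism f -> f (symbol_comb x y c) = symbol_comb (f x) (f y) c.
Proof.
case/algebra_morphismP => F fF; rewrite !fF linear_sum; apply: eq_bigr => i _.
rewrite linear_sum; apply: eq_bigr => j _; rewrite linearZ; congr (_ *: _).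
by rewrite /= rmorphM !rmorphXn.
Qed.

Lemma symbol_comb_comm T (x y z : T) (c : 'M_p) :
  x * z = z * x -> y * z = z * y -> symbol_comb x y c * z = z * symbol_comb x y c.
Proof.
move=> xz yz; rewrite mulr_suml mulr_sumr; apply: eq_bigr => i _.
rewrite mulr_suml mulr_sumr; apply: eq_bigr => j _.
rewrite -scalerAl -scalerAr; congr (_ *: _).
by apply/commr_sym/commrM; apply: commrX; exact/commr_sym.
Qed.

Lemma symbol_iso a b S T (x y : T) : b != 0 -> symb a b S ->
  dim T = (p * p)%N -> pair a b x y -> iso S T.
Proof.
move=> b0 [dS [xS [yS xyS]]] dT xy.
have [f mf [fx fy]] := symbol_univ pcharK b0 dS xyS xy.
apply: (iso_of_inj mf); last by rewrite dS dT.
move=> s; have [c <-] := symbol_comb_surj pcharK b0 dS xyS s.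
rewrite (symbol_comb_morph _ _ _ mf) fx fy => /(symbol_comb_inj pcharK xy b0) ->.
exact: symbol_comb0.
Qed.

(** This is the recognition principle: applied with [T] a tensor product of two other symbol
    algebras, it turns a change of generators into an isomorphism. *)
Lemma symbol_tensor_iso a b a' b' S S' T (x y x' y' : T) :
  b != 0 -> b' != 0 -> symb a b S -> symb a' b' S' ->
  dim T = (p * p * (p * p))%N -> pair a b x y -> pair a' b' x' y' ->
  [/\ x * x' = x' * x, x * y' = y' * x, y * x' = x' * y & y * y' = y' * y] ->
  iso (tensor S S') T.
Proof.
move=> b0 b0' symS symS' dT xy xy' [xx xy_ yx yy].
have [dS [xS [yS xyS]]] := symS; have [dS' [xS' [yS' xyS']]] := symS'.
have [f mf [fx fy]] := symbol_univ pcharK b0 dS xyS xy.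
have [g mg [gx gy]] := symbol_univ pcharK b0' dS' xyS' xy'.
have fg s t : f s * g t = g t * f s.
  have [c <-] := symbol_comb_surj pcharK b0 dS xyS s.
  have [d <-] := symbol_comb_surj pcharK b0' dS' xyS' t.
  rewrite !(symbol_comb_morph _ _ _ mf) !(symbol_comb_morph _ _ _ mg) fx fy gx gy.
  by apply: symbol_comb_comm; apply/esym/symbol_comb_comm.
apply: (iso_of_inj (tensor_map_morphism mf mg fg)); last by rewrite dim_tensor dS dS' dT.
apply: (symbol_tensor_inj pcharK b0 symS mf mg fg) => t.
have [d <-] := symbol_comb_surj pcharK b0' dS' xyS' t.
rewrite (symbol_comb_morph _ _ _ mg) gx gy => /(symbol_comb_inj pcharK xy' b0') ->.
exact: symbol_comb0.
Qed.

Lemma dim_matrix_p : dim 'M[K]_p.-1.+1 = (p * p)%N.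
Proof. by rewrite dim_matrix prednK. Qed.

Lemma symbol_1_split a S : symb a 1 S -> is_matrix_algebra S.
Proof.
move=> symS; have [x [y xy]] := split_symbol_1 pcharK a.
by exists p.-1; apply: symbol_iso symS dim_matrix_p xy; exact: oner_neq0.
Qed.

Lemma symbol_0_split b S : b != 0 -> symb 0 b S -> is_matrix_algebra S.
Proof.
move=> b0 symS; have [x [y xy]] := split_symbol_0 pcharK b.
by exists p.-1; apply: symbol_iso symS dim_matrix_p xy.
Qed.

Lemma exprD_pchar_comm T (x y : T) :
  x * y = y * x -> (x + y) ^+ p = x ^+ p + y ^+ p.
Proof.
move=> xy; have cT := pcharT pcharK T.
by rewrite -!(pFrobenius_autE cT) pFrobenius_autD_comm.
Qed.

Lemma exprN_pchar T (x : T) : (- x) ^+ p = - x ^+ p.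
Proof.
by have cT := pcharT pcharK T; rewrite -!(pFrobenius_autE cT) pFrobenius_autN.
Qed.

Lemma symbol_pair_inj a b S T (f : S -> T) (x y : S) :
  algebra_morphism f -> injective f -> pair a b (f x) (f y) -> pair a b x y.
Proof.
move=> /algebra_morphismP[F fF] injf [h1 h2 h3].
have FA c : F c%:A = c%:A by rewrite linearZ rmorph1.
move: h1 h2 h3; rewrite !fF => h1 h2 h3.
split; apply: injf; rewrite !fF.
- by rewrite rmorphB rmorphXn /= FA.
- by rewrite rmorphXn /= FA.
- by rewrite !rmorphM rmorphD rmorph1.
Qed.

(** [a, b) is found inside the tensor product of the split algebras [a, 1) and [0, b): the sum of
    the two [x] together with the second [y] is a symbol pair for [a] and [b], and its monomials
    span a subalgebra of dimension p^2. *)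
Lemma exists_symbol_algebra a b : b != 0 -> exists S, symb a b S.
Proof.
move=> b0; have [x1 [y1 xy1]] := split_symbol_1 pcharK a.
have [x2 [y2 xy2]] := split_symbol_0 pcharK b.
pose T := tensor 'M[K]_p.-1.+1 'M[K]_p.-1.+1.
have {}xy1 := symbol_pair_morph (tensor_inl_morphism _ 'M[K]_p.-1.+1) xy1.
have {}xy2 := symbol_pair_morph (tensor_inr_morphism 'M[K]_p.-1.+1 _) xy2.
pose x : T := tensor_inl _ x1 + tensor_inr _ x2; pose y : T := tensor_inr _ y2.
have xx : tensor_inl 'M[K]_p.-1.+1 x1 * tensor_inr 'M[K]_p.-1.+1 x2 =
          tensor_inr 'M[K]_p.-1.+1 x2 * tensor_inl 'M[K]_p.-1.+1 x1.
  by rewrite tensor_inlr tensor_inrl.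
have xy : pair a b x y.
  case: xy1 => h1 _ _; case: xy2 => h2 h3 h4; split=> //.
    by rewrite /x exprD_pchar_comm // opprD addrACA h1 h2 scale0r addr0.
  by rewrite /x mulrDr h4 tensor_inrl -tensor_inlr -mulrDl addrA.
pose F : {linear 'M[K]_p -> T} :=
  HB.pack (symbol_comb x y)
    (GRing.isLinear.Build K 'M[K]_p T _ (symbol_comb x y) (symbol_combP x y)).
pose U := limg (linfun F).
have UP z : reflect (exists c : 'M[K]_p, symbol_comb x y c = z) (z \in U).
  apply: (iffP memv_imgP) => [[c _ ->]|[c <-]]; exists c; rewrite ?lfunE ?memvf //.
have Umon i j (ip : (i < p)%N) (jp : (j < p)%N) : x ^+ i * y ^+ j \in U.
  by apply/UP; exists (delta_mx (Ordinal ip) (Ordinal jp)); rewrite symbol_comb_delta.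
have U1 : 1 \in U by have := Umon 0%N 0%N p_gt0 p_gt0; rewrite !expr0 mulr1.
have Ux : x \in U by have := Umon 1%N 0%N p_gt1 p_gt0; rewrite expr0 mulr1 expr1.
have Uy : y \in U by have := Umon 0%N 1%N p_gt0 p_gt1; rewrite expr0 mul1r expr1.
have dU : \dim U = (p * p)%N.
  rewrite limg_dim_eq ?dimvf ?dim_matrix //; apply/eqP; rewrite -subv0.
  apply/subvP => c; rewrite memv_cap memv_ker lfunE /= => /andP[_ /eqP].
  by move/(symbol_comb_inj pcharK xy b0) => ->; rewrite mem0v.
have asU : is_aspace U.
  rewrite /is_aspace has_algid1 //=; apply/prodvP => u v /UP[c <-] /UP[d <-].
  have [e He] := reducible_combM pcharK a b c d.
  by apply/UP; exists e; rewrite He.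
pose A := ASpace asU; pose S : falgType K := subvs_of A.
have mval : algebra_morphism (vsval : S -> T).
  by split=> //; apply/eqP; rewrite algid_eq1.
exists S; split; first exact: dU.
by exists (Subvs Ux), (Subvs Uy); apply: (symbol_pair_inj mval subvs_inj).
Qed.

Section TensorOfSymbols.

Variables (a b a' b' : K) (S S' : falgType K) (xS yS : S) (xS' yS' : S').
Hypotheses (b0 : b != 0) (b0' : b' != 0).
Hypotheses (xyS : pair a b xS yS) (xyS' : pair a' b' xS' yS').

Local Notation T := (tensor S S').
Let x : T := tensor_inl S' xS.
Let y : T := tensor_inl S' yS.
Let x' : T := tensor_inr S xS'.
Let y' : T := tensor_inr S yS'.

Lemma tensor_pairl : pair a b x y.
Proof. exact: symbol_pair_morph (tensor_inl_morphism _ _) xyS. Qed.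
Lemma tensor_pairr : pair a' b' x' y'.
Proof. exact: symbol_pair_morph (tensor_inr_morphism _ _) xyS'. Qed.

Lemma tensor_lrC s s' : tensor_inl S' s * tensor_inr S s' =
                        tensor_inr S s' * tensor_inl S' s.
Proof. by rewrite tensor_inlr tensor_inrl. Qed.

(** Two changes of generators are prepared here. If b = b', the pairs x + x', y and x', y^-1 y'
    commute and present the product as [a + a', b) tensored with [a', 1). If a = a', the pairs x, y
    y' and x' - x, y' present it as [a, b b') tensored with [0, b'). In both cases the second factor
    is split. *)
Lemma tensor_pair_mulx : pair (a + a') b (x + x') y.
Proof.
have [h1 h2 h3] := tensor_pairl; have [k1 _ _] := tensor_pairr; split=> //.
  by rewrite exprD_pchar_comm ?tensor_lrC // opprD addrACA h1 k1 scalerDl.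
by rewrite mulrDr h3 [y * x']tensor_lrC -mulrDl addrAC.
Qed.

Lemma tensor_pair_muly : a = a' -> pair a (b * b') x (y * y').
Proof.
move=> aa'; have [h1 h2 h3] := tensor_pairl; have [k1 k2 k3] := tensor_pairr; split=> //.
  rewrite exprMn_comm; last exact: tensor_lrC.
  by rewrite h2 k2 -scalerAl mul1r scalerA.
by rewrite -mulrA -[y' * x]tensor_lrC mulrA h3 mulrA.
Qed.

Lemma tensor_pair_subx : a = a' -> pair 0 b' (x' - x) y'.
Proof.
move=> aa'; have [h1 h2 h3] := tensor_pairl; have [k1 k2 k3] := tensor_pairr; split=> //.
  rewrite exprD_pchar_comm ?mulrN ?mulNr ?tensor_lrC // exprN_pchar opprD addrACA k1.
  by rewrite -opprD h1 aa' subrr scale0r.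
by rewrite mulrBr k3 -[y' * x]tensor_lrC -mulrBl addrAC.
Qed.

Lemma tensor_pair_divy : b = b' -> pair a' 1 x' (y^-1 * y').
Proof.
move=> bb'; have [h1 h2 h3] := tensor_pairl; have [k1 k2 k3] := tensor_pairr.
have yu : y \is a GRing.unit := symbol_y_unit pcharK tensor_pairl b0.
have yx' : x' * y^-1 = y^-1 * x'.
  by apply: commrV; rewrite /GRing.comm tensor_lrC.
split=> //.
  rewrite exprMn_comm; last by apply/commr_sym/commrV; rewrite /GRing.comm tensor_lrC.
  by rewrite exprVn k2 -bb' -h2 mulVr ?unitrX // scale1r.
by rewrite -mulrA k3 !mulrDl !mulrDr !mul1r !mulrA yx'.
Qed.

Lemma tensor_pair_commx : [/\ (x + x') * x' = x' * (x + x'),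
  (x + x') * (y^-1 * y') = (y^-1 * y') * (x + x'), y * x' = x' * y &
  y * (y^-1 * y') = (y^-1 * y') * y].
Proof.
have [h1 h2 h3] := tensor_pairl; have [k1 k2 k3] := tensor_pairr.
have yu : y \is a GRing.unit := symbol_y_unit pcharK tensor_pairl b0.
have yx' : x' * y^-1 = y^-1 * x'.
  by apply: commrV; rewrite /GRing.comm tensor_lrC.
have xy : x * y^-1 = y^-1 * (x + 1).
  by apply: (mulrI yu); rewrite /= [LHS]mulrA h3 mulrK // mulVKr.
split; rewrite ?tensor_lrC //.
- by rewrite mulrDl mulrDr tensor_lrC.
- rewrite mulrA mulrDl xy yx' -mulrDr -!mulrA; congr (_ * _).
  rewrite mulrDr k3 -[y' * x]tensor_lrC -mulrDl; congr (_ * _).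
  by rewrite -addrA [1 + _]addrC.
by rewrite mulrA mulrV // mul1r -mulrA -[y' * y]tensor_lrC mulKr.
Qed.

Lemma tensor_pair_commy : [/\ x * (x' - x) = (x' - x) * x,
  x * y' = y' * x, (y * y') * (x' - x) = (x' - x) * (y * y') &
  (y * y') * y' = y' * (y * y')].
Proof.
have [h1 h2 h3] := tensor_pairl; have [k1 k2 k3] := tensor_pairr.
split; [|exact: tensor_lrC| |].
- by rewrite mulrBl mulrBr tensor_lrC.
- have yx' : y * (x' + 1) = (x' + 1) * y.
    by rewrite mulrDr mulrDl mulr1 mul1r [y * x']tensor_lrC.
  have e1 : y * y' * x' = (x' + 1) * (y * y') by rewrite -mulrA k3 mulrA yx' mulrA.
  have e2 : y * y' * x = (x + 1) * (y * y').
    by rewrite -mulrA -[y' * x]tensor_lrC mulrA h3 mulrA.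
  by rewrite mulrBr e1 e2 -mulrBl opprD addrACA subrr addr0.
by rewrite [RHS]mulrA -[y' * y]tensor_lrC.
Qed.

End TensorOfSymbols.

Lemma symbol_add a a' b S S' S'' : b != 0 ->
  symb a b S -> symb a' b S' -> symb (a + a') b S'' ->
  brauer_equiv (tensor S S') S''.
Proof.
move=> b0 [dS [xS [yS xyS]]] [dS' [xS' [yS' xyS']]] symS''.
have [N symN] := exists_symbol_algebra a' (oner_neq0 K).
apply: brauer_sym.
have N0 := matrix_brauer (symbol_1_split symN).
apply: brauer_trans (brauer_sym (brauer_tensor0 _ N0)) _.
apply: iso_brauer.
apply: (symbol_tensor_iso b0 (oner_neq0 K) symS'' symN _
  (tensor_pair_mulx xyS xyS') (tensor_pair_divy b0 xyS xyS' (erefl b))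
  (tensor_pair_commx b0 xyS xyS')).
by rewrite dim_tensor dS dS'.
Qed.

Lemma symbol_mul a b b' S S' S'' : b != 0 -> b' != 0 ->
  symb a b S -> symb a b' S' -> symb a (b * b') S'' ->
  brauer_equiv (tensor S S') S''.
Proof.
move=> b0 b0' [dS [xS [yS xyS]]] [dS' [xS' [yS' xyS']]] symS''.
have [N symN] := exists_symbol_algebra 0 b0'.
apply: brauer_sym.
have N0 := matrix_brauer (symbol_0_split b0' symN).
apply: brauer_trans (brauer_sym (brauer_tensor0 _ N0)) _.
apply: iso_brauer.
apply: (symbol_tensor_iso _ b0' symS'' symN _
  (tensor_pair_muly xyS xyS' (erefl a)) (tensor_pair_subx xyS xyS' (erefl a))
  (tensor_pair_commy xyS xyS')).
  by rewrite mulf_neq0.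
by rewrite dim_tensor dS dS'.
Qed.

(** Replacing [x] by [x - c] turns the presentation into that of [0, b). *)
Lemma symbol_artin_schreier c b S : b != 0 -> symb (c ^+ p - c) b S ->
  brauer_equiv S (K^o : falgType K).
Proof.
move=> b0 [dS [x [y [h1 h2 h3]]]]; apply/matrix_brauer/(symbol_0_split b0).
split=> //; exists (x - c%:A), y; split=> //.
  rewrite exprD_pchar_comm ?mulrN ?mulNr ?mulr_algl ?mulr_algr // exprN_pchar.
  rewrite opprD addrACA h1 -opprD; apply/eqP; rewrite scale0r subr_eq0; apply/eqP.
  by rewrite -[c%:A]/(in_alg S c) -rmorphXn /= scalerBl.
by rewrite mulrBr h3 mulr_algr -[c *: y]mulr_algl -mulrBl addrAC.
Qed.

(** Both sides are monic of degree p and vanish on the prime field. Evaluated at a generator [x] of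
    a symbol algebra, the identity computes the norm in [symbol_self]. *)
Lemma prod_translates : \prod_(i < p) ('X + (i%:R)%:P) = 'X^p - 'X :> {poly K}.
Proof.
pose rs := [seq - (i%:R : K) | i <- iota 0 p].
have srs : size rs = p by rewrite size_map size_iota.
have sQ : size ('X^p - 'X : {poly K}) = p.+1.
  by rewrite size_polyDl size_polyXn // size_polyN size_polyX.
have lQ : lead_coef ('X^p - 'X : {poly K}) = 1.
  by rewrite lead_coefDl ?lead_coefXn // size_polyN size_polyX size_polyXn.
have := @all_roots_prod_XsubC _ ('X^p - 'X : {poly K}) rs.
rewrite sQ srs lQ scale1r => -> //.
- rewrite big_map -(big_mkord xpredT (fun i => 'X + (i%:R)%:P)) /index_iota subn0.
  by apply: eq_bigr => i _; rewrite polyCN opprK.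
- apply/allP => z /mapP[i _ ->]; rewrite /root !hornerE.
  by rewrite -(pFrobenius_autE pcharK) pFrobenius_autN pFrobenius_aut_nat subrr.
rewrite uniq_rootsE map_inj_in_uniq ?iota_uniq // => i j.
by rewrite !mem_iota /= !add0n => ip jp /oppr_inj /(natr_inj_p pcharK ip jp).
Qed.

(* Replacing y by x^-1 y divides y^p by the norm x (x + 1) ... (x + p - 1) of
   x, which is a. *)
Lemma symbol_self a S : a != 0 -> symb a a S -> brauer_equiv S (K^o : falgType K).
Proof.
move=> a0 [dS [x [y [h1 h2 h3]]]]; apply/matrix_brauer/(@symbol_1_split a).
split=> //; have xu : x \is a GRing.unit.
  apply/unitrP; exists (a^-1 *: (x ^+ p.-1 - 1)).
  rewrite -scalerAl -scalerAr mulrBl mulrBr mulr1 mul1r -exprS -exprSr prednK // h1.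
  by rewrite scalerA mulVf // scale1r.
pose z := x^-1 * y; exists x, z.
have zx : z * x = (x + 1) * z.
  rewrite /z -mulrA h3 mulrDl mul1r mulrDl mul1r mulrDr mulKr // mulVKr //.
have zX k : (x * z) ^+ k = (\prod_(i < k) (x + i%:R)) * z ^+ k.
  have zk j : z ^+ j * x = (x + j%:R) * z ^+ j.
    elim: j => [|j IHj]; first by rewrite !expr0 mul1r addr0 mulr1.
    rewrite exprS -mulrA IHj mulrA mulrDr zx (commr_nat z j) -mulrDl -mulrA -exprS.
    by rewrite -addrA nat1r.
  elim: k => [|k IHk]; first by rewrite !expr0 big_ord0 mulr1.
  by rewrite exprSr IHk big_ord_recr /= mulrA -(mulrA _ (z ^+ k)) zk (exprSr z) !mulrA.
split=> //; have := zX p; rewrite /z mulVKr // h2 -/z.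
have -> : \prod_(i < p) (x + i%:R) = a%:A.
  have := congr1 (horner_alg x) prod_translates.
  rewrite rmorph_prod rmorphB rmorphXn /= horner_algX h1 => <-.
  by apply: eq_bigr => i _; rewrite rmorphD /= horner_algX horner_algC scaler_nat.
by rewrite mulr_algl scale1r => h; apply: (scalerI a0); rewrite -h.
Qed.

End SymbolRelations.

(** * Elementary properties of discrete valuations *)

Section Valuation.

Variables (K : fieldType) (v : K -> int).
Hypothesis dv : discrete_valuation v.
Local Notation ge := (val_ge v).

Lemma dval1 : v 1 = 0.
Proof.
have h : v 1 = v 1 + v 1 by rewrite -(dvalM dv) ?oner_neq0 // mulr1.
lia.
Qed.

Lemma dvalV x : x != 0 -> v x^-1 = - v x.
Proof.
move=> x0; have := dvalM dv x0 (invr_neq0 x0); rewrite divff // dval1; lia.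
Qed.

Lemma dvalN x : x != 0 -> v (- x) = v x.
Proof.
move=> x0; have n10 : -1 != 0 :> K by rewrite oppr_eq0 oner_neq0.
have := dvalM dv n10 n10; rewrite mulrNN mulr1 dval1 => h.
by rewrite -mulN1r (dvalM dv n10 x0); lia.
Qed.

Lemma dvalXz x (k : int) : x != 0 -> v (x ^ k) = k * v x.
Proof.
move=> x0; have valXn (n : nat) : v (x ^+ n) = n%:Z * v x.
  elim: n => [|n IHn]; first by rewrite expr0 dval1; lia.
  by rewrite exprS (dvalM dv) ?expf_neq0 // IHn; lia.
case: k => n; first by rewrite -exprnP valXn.
by rewrite NegzE -exprnN dvalV ?expf_neq0 // valXn; lia.
Qed.

Lemma val_geE k x : x != 0 -> ge k x = (k <= v x).
Proof. by rewrite /val_ge => /negPf->. Qed.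

Lemma val_ge0 k : ge k 0. Proof. by rewrite /val_ge eqxx. Qed.

Lemma val_ge_mono j k x : j <= k -> ge k x -> ge j x.
Proof. by rewrite /val_ge => jk; case: eqP => //= _; exact: le_trans. Qed.

Lemma val_geM j k x y : ge j x -> ge k y -> ge (j + k) (x * y).
Proof.
have [->|x0] := eqVneq x 0; first by rewrite mul0r !val_ge0.
have [->|y0] := eqVneq y 0; first by rewrite mulr0 !val_ge0.
by rewrite !val_geE ?mulf_neq0 // (dvalM dv) //; lia.
Qed.

Lemma dval_add_ge x y : x != 0 -> y != 0 -> x + y != 0 ->
  v x <= v (x + y) \/ v y <= v (x + y).
Proof.
by move=> x0 y0 xy0; apply/orP; have := dvalD dv x0 y0 xy0; rewrite ge_min.
Qed.

Lemma val_geD k x y : ge k x -> ge k y -> ge k (x + y).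
Proof.
have [->|x0] := eqVneq x 0; first by rewrite add0r.
have [->|y0] := eqVneq y 0; first by rewrite addr0.
have [->|xy0] := eqVneq (x + y) 0; first by rewrite val_ge0.
by rewrite !val_geE //; have [h|h] := dval_add_ge x0 y0 xy0 => kx ky; exact: le_trans h.
Qed.

Lemma val_geN k x : ge k x -> ge k (- x).
Proof.
have [->|x0] := eqVneq x 0; first by rewrite oppr0.
by rewrite !val_geE ?oppr_eq0 // dvalN.
Qed.

Lemma val_geMz k x (z : int) : ge k x -> ge k (x *~ z).
Proof.
move=> kx; have gen (n : nat) : ge k (x *+ n).
  by elim: n => [|n IHn]; rewrite ?mulr0n ?val_ge0 // mulrS val_geD.
by case: z => n; rewrite -?pmulrn ?NegzE ?mulrNz -?pmulrn ?val_geN.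
Qed.

Lemma val_ge_divu k x y : y != 0 -> v y = 0 -> ge k x -> ge k (x / y).
Proof.
move=> y0 vy kx; rewrite -[k]addr0; apply: val_geM => //.
by rewrite val_geE ?invr_neq0 // dvalV // vy.
Qed.

Lemma val_ge1_neq0 w : ge 1 w -> 1 + w != 0.
Proof.
move=> w1; apply/eqP => /eqP; rewrite addrC addr_eq0 => /eqP w0.
by move: w1; rewrite w0 val_geE ?oppr_eq0 ?oner_neq0 // dvalN ?oner_neq0 // dval1.
Qed.

Lemma dval_addl x y : x != 0 -> ge (v x + 1) y -> x + y != 0 /\ v (x + y) = v x.
Proof.
move=> x0; have [->|y0] := eqVneq y 0; first by rewrite addr0.
rewrite val_geE // => xy; have xy0 : x + y != 0.
  by apply/eqP => /eqP; rewrite addr_eq0 => /eqP xE; move: xy; rewrite xE dvalN //; lia.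
split=> //; have h1 := dval_add_ge x0 y0 xy0.
have ny0 : - y != 0 by rewrite oppr_eq0.
have := dval_add_ge xy0 ny0; rewrite addrK => /(_ x0); rewrite dvalN //.
by case: h1 => h1 []; lia.
Qed.

Lemma dval_1D w : ge 1 w -> v (1 + w) = 0.
Proof.
move=> w1; have [] := @dval_addl 1 w (oner_neq0 K); first by rewrite dval1.
by rewrite dval1.
Qed.

End Valuation.

(** * The filtration by pole order and the reduction to n symbols *)

Section SymbolFiltration.

Variables (K F : fieldType) (p n : nat) (v : K -> int) (r : K -> F).
Hypotheses (pcharK : p \in [pchar K]) (dv : discrete_valuation v).
Hypothesis (rm : residue_map v r).
Variables (G : zmodType) (sy : K -> K -> G) (t : 'I_n -> K).

Hypothesis syD : forall a a' b, b != 0 -> sy (a + a') b = sy a b + sy a' b.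
Hypothesis syM : forall a b b', b != 0 -> b' != 0 ->
  sy a (b * b') = sy a b + sy a b'.
Hypothesis sy_self : forall a, a != 0 -> sy a a = 0.
Hypothesis sy_max : forall a b, b != 0 -> val_ge v 1 a -> sy a b = 0.

Hypothesis t_unit : forall k, t k != 0 /\ v (t k) = 0.
Hypothesis t_gen : forall P : F -> Prop,
  (forall x, P (x ^+ p)) -> (forall k, P (r (t k))) ->
  (forall x y, P x -> P y -> P (x + y)) ->
  (forall x y, P x -> P y -> P (x * y)) -> forall x, P x.

Local Notation ge := (val_ge v).

Lemma sy0 b : b != 0 -> sy 0 b = 0.
Proof.
move=> b0; have /eqP := syD 0 0 b0.
by rewrite addr0 -subr_eq subrr eq_sym => /eqP.
Qed.

Lemma syN a b : b != 0 -> sy (- a) b = - sy a b.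
Proof. by move=> b0; apply/eqP; rewrite -addr_eq0 -syD // addNr sy0. Qed.

Lemma syMz a b z : b != 0 -> sy (a *~ z) b = sy a b *~ z.
Proof.
move=> b0; have gen (m : nat) : sy (a *+ m) b = sy a b *+ m.
  by elim: m => [|m IHm]; rewrite ?mulr0n ?sy0 // !mulrS syD ?IHm.
by case: z => m; rewrite ?NegzE ?mulrNz -?pmulrn ?syN ?gen.
Qed.

Lemma sy1 a : sy a 1 = 0.
Proof.
have := syM a (oner_neq0 K) (oner_neq0 K); rewrite mulr1 => /eqP.
by rewrite -subr_eq subrr eq_sym => /eqP.
Qed.

Lemma syXz a b z : b != 0 -> sy a (b ^ z) = sy a b *~ z.
Proof.
move=> b0; have gen (m : nat) : sy a (b ^+ m) = sy a b *+ m.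
  by elim: m => [|m IHm]; rewrite ?expr0 ?sy1 // exprS mulrS syM ?expf_neq0 ?IHm.
case: z => m; first by rewrite -exprnP -pmulrn gen.
rewrite NegzE -exprnN mulrNz -pmulrn -gen; apply/eqP; rewrite -addr_eq0.
by rewrite -syM ?invr_neq0 ?expf_neq0 // mulVf ?expf_neq0 // sy1.
Qed.

Lemma sy_p a b : b != 0 -> sy a b *+ p = 0.
Proof.
move=> b0; rewrite pmulrn -syMz // -pmulrn -mulr_natr (pcharf0 pcharK).
by rewrite mulr0 sy0.
Qed.

(* [syd c b] is the class of the differential form c db. *)
Definition syd c b : G := if b == 0 then 0 else sy (c * b) b.

(** Expanding {cb, cb} = 0 removes [b] from the second entry, so that additivity in [b] becomes
    additivity in the first entry. *)
Lemma syd_swap c b : c != 0 -> syd c b = - sy (c * b) c.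
Proof.
move=> c0; rewrite /syd; case: eqP => [->|/eqP b0].
  by rewrite mulr0 sy0 // oppr0.
apply/eqP; rewrite -addr_eq0 -syM // [b * c]mulrC.
by rewrite sy_self ?mulf_neq0.
Qed.

Lemma sydD c b b' : syd c (b + b') = syd c b + syd c b'.
Proof.
have [->|c0] := eqVneq c 0.
  by rewrite /syd !mul0r; do 3![case: eqP => [_|/eqP ?]]; rewrite ?sy0 ?addr0.
by rewrite !syd_swap // mulrDr syD // opprD.
Qed.

Lemma sydM c b b' : syd c (b * b') = syd (c * b') b + syd (c * b) b'.
Proof.
have [->|b0] := eqVneq b 0.
  rewrite /syd mul0r eqxx mulr0 mul0r.
  by case: eqP => [_|/eqP ?]; rewrite ?sy0 ?addr0.
have [->|b0'] := eqVneq b' 0.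
  by rewrite /syd mulr0 eqxx mulr0 mul0r (negPf b0) sy0 // addr0.
by rewrite /syd mulf_eq0 (negPf b0) (negPf b0') /= syM // -!mulrA [b' * b]mulrC.
Qed.

Lemma syd_div a b : b != 0 -> sy a b = syd (a / b) b.
Proof. by move=> b0; rewrite /syd (negPf b0) divfK. Qed.

(** The index is an integer so that the descent can end at -1, where the first entries lie in the
    maximal ideal and [sy_max] kills every generator. *)
Definition fil (j : int) (g : G) : Prop := exists2 s : seq (K * K),
  all (fun ab => (ab.2 != 0) && ge (- j) ab.1) s & g = \sum_(ab <- s) sy ab.1 ab.2.

Lemma fil0 j : fil j 0.
Proof. by exists [::] => //; rewrite big_nil. Qed.

Lemma fil_sy j a b : b != 0 -> ge (- j) a -> fil j (sy a b).
Proof. by move=> b0 ja; exists [:: (a, b)]; rewrite ?big_seq1 //= b0 ja. Qed.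

Lemma filD j g h : fil j g -> fil j h -> fil j (g + h).
Proof.
by case=> s as_ -> [s' as' ->]; exists (s ++ s'); rewrite ?all_cat ?as_ ?big_cat.
Qed.

Lemma filN j g : fil j g -> fil j (- g).
Proof.
case=> s + ->; elim: s => [|[a b] s IHs] /=.
  by rewrite big_nil oppr0 => _; exact: fil0.
case/andP=> /andP[b0 ja] /IHs h; rewrite big_cons opprD; apply: filD => //.
by rewrite -syN //; apply: fil_sy => //; exact: val_geN.
Qed.

(** These are the elements whose part of degree [j] involves the [t k] only, with no contribution of
    the uniformizer. *)
Definition leading (j : int) (g : G) : Prop := exists2 c : 'I_n -> K,
  forall k, ge (- j) (c k) & fil (j - 1) (g - \sum_k sy (c k) (t k)).

Lemma leadingD j g h : leading j g -> leading j h -> leading j (g + h).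
Proof.
case=> c jc fg [d jd fh]; exists (fun k => c k + d k) => [k|]; first exact: val_geD.
have -> : \sum_k sy (c k + d k) (t k) = \sum_k sy (c k) (t k) + \sum_k sy (d k) (t k).
  by rewrite -big_split; apply: eq_bigr => k _; rewrite syD ?(t_unit k).1.
by rewrite opprD addrACA; exact: filD.
Qed.

Lemma leadingN j g : leading j g -> leading j (- g).
Proof.
case=> c jc fg; exists (fun k => - c k) => [k|]; first exact: val_geN.
have -> : \sum_k sy (- c k) (t k) = - \sum_k sy (c k) (t k).
  by rewrite -sumrN; apply: eq_bigr => k _; rewrite syN ?(t_unit k).1.
by rewrite -opprD; exact: filN.
Qed.

Lemma leading_fil j g : fil (j - 1) g -> leading j g.
Proof.
move=> fg; exists (fun=> 0) => [k|]; first exact: val_ge0.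
by rewrite big1 ?subr0 // => k _; rewrite sy0 ?(t_unit k).1.
Qed.

Lemma leadingMz j g z : leading j g -> leading j (g *~ z).
Proof.
move=> lg; have gen (m : nat) : leading j (g *+ m).
  elim: m => [|m IHm]; first by rewrite mulr0n; apply/leading_fil/fil0.
  by rewrite mulrS; exact: leadingD.
by case: z => m; rewrite ?NegzE ?mulrNz -?pmulrn; [|apply: leadingN].
Qed.

Lemma leading_t j c k : ge (- j) c -> leading j (sy c (t k)).
Proof.
move=> jc; exists (fun i => if i == k then c else 0) => [i|].
  by case: eqP => // _; exact: val_ge0.
rewrite (bigD1 k) //= eqxx big1 ?addr0 ?subrr; first exact: fil0.
by move=> i /negPf->; rewrite sy0 ?(t_unit i).1.
Qed.

Lemma syd_max j c w : ge (- j) c -> ge 1 w -> fil (j - 1) (syd c w).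
Proof.
move=> jc w1; rewrite /syd; case: eqP => [_|/eqP w0]; first exact: fil0.
by apply: fil_sy => //; rewrite opprB addrC; exact: val_geM.
Qed.

Lemma maxE x : (x \in val_max v) = ge 1 x. Proof. by []. Qed.

Lemma r_sub x y : ge 0 x -> ge 0 y -> r x = r y -> ge 1 (x - y).
Proof.
move=> x0 y0 rxy; have xy0 : ge 0 (x - y) by apply: val_geD => //; exact: val_geN.
rewrite -maxE -(res_ker rm xy0); have := resD rm xy0 y0; rewrite subrK rxy.
by move=> e; rewrite -[r (x - y)](addrK (r y)) -e subrr.
Qed.

(** The residues of those [b] for which c db is [leading] are closed under sums and, by the Leibniz
    rule, under products; they contain the residues of the [t k], and the p-th powers because d(f^p)
    = 0. *)
Lemma leading_syd j b : ge 0 b -> forall c, ge (- j) c -> leading j (syd c b).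
Proof.
(* All lifts [b] of a residue [y] are considered at once, so that [t_gen] applies to a property of
   [y]; two lifts differ by an element of the maximal ideal, whose effect lies in [fil (j - 1)] by
   [syd_max]. *)
suff gen : forall y b, ge 0 b -> r b = y -> forall c, ge (- j) c -> leading j (syd c b).
  by move=> b0; exact: gen b0 (erefl _).
move=> {b}; have approx b1 b2 : ge 0 b1 -> ge 0 b2 -> r b1 = r b2 ->
    (forall c, ge (- j) c -> leading j (syd c b1)) ->
    forall c, ge (- j) c -> leading j (syd c b2).
  move=> b10 b20 rb h c jc; rewrite -[b2](subrK b1) sydD addrC.
  apply: leadingD; first exact: h.
  by apply/leading_fil/syd_max => //; exact: r_sub.
have geM0 x y : ge 0 x -> ge 0 y -> ge 0 (x * y).
  by move=> x0 y0; have := val_geM dv x0 y0; rewrite addr0.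
have geX0 x m : ge 0 x -> ge 0 (x ^+ m).
  move=> x0; elim: m => [|m IHm]; last by rewrite exprS geM0.
  by rewrite expr0 val_geE ?oner_neq0 // dval1.
have get k : ge 0 (t k) by have [t0 vt] := t_unit k; rewrite val_geE // vt.
apply: t_gen => [x|k|x y hx hy|x y hx hy] b b0 rb.
- have [f f0 rf] := res_surj rm x.
  have rfX m : r (f ^+ m) = x ^+ m.
    elim: m => [|m IHm]; first by rewrite !expr0 (res1 rm).
    by rewrite !exprS (resM rm f0 (geX0 _ m f0)) IHm rf.
  apply: (approx (f ^+ p)); rewrite ?rfX //; first exact: geX0.
  move=> c jc.
  rewrite /syd; case: eqP => [_|/eqP fp0]; first exact/leading_fil/fil0.
  have f00 : f != 0.
    apply: contraNneq fp0 => ->.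
    by rewrite expr0n gtn_eqF ?prime_gt0 ?(pcharf_prime pcharK).
  by rewrite exprnP syXz // -pmulrn sy_p //; exact/leading_fil/fil0.
- apply: (approx (t k)) => // c jc; rewrite /syd (negPf (t_unit k).1).
  by apply: leading_t; rewrite -[- j]addr0; exact: val_geM.
- have [b1 b10 rb1] := res_surj rm x; have [b2 b20 rb2] := res_surj rm y.
  apply: (approx (b1 + b2)); rewrite ?(resD rm) ?rb1 ?rb2 //; first exact: val_geD.
  move=> c jc.
  by rewrite sydD; apply: leadingD; [exact: hx|exact: hy].
have [b1 b10 rb1] := res_surj rm x; have [b2 b20 rb2] := res_surj rm y.
apply: (approx (b1 * b2)); rewrite ?(resM rm) ?rb1 ?rb2 //; first exact: geM0.
move=> c jc.
have jcM z : ge 0 z -> ge (- j) (c * z) by move=> z0; rewrite -[- j]addr0; exact: val_geM.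
by rewrite sydM; apply: leadingD; [apply: hx => //|apply: hy => //]; exact: jcM.
Qed.

Lemma leading_unit j a u : u != 0 -> v u = 0 -> ge (- j) a -> leading j (sy a u).
Proof.
move=> u0 vu ja; rewrite syd_div //; apply: leading_syd.
  by rewrite val_geE // vu.
exact: val_ge_divu.
Qed.

Variable pi : K.
Hypotheses (pi0 : pi != 0) (vpi : v pi = 1).

Lemma unif_decomp b : b != 0 -> exists u, [/\ u != 0, v u = 0 & b = pi ^ v b * u].
Proof.
move=> b0; have pz : pi ^ v b != 0 by rewrite expfz_neq0.
exists (b / pi ^ v b); split; first by rewrite mulf_neq0 ?invr_neq0.
  by rewrite (dvalM dv) ?invr_neq0 // dvalV // dvalXz // vpi; lia.
by rewrite mulrC divfK.
Qed.

Lemma ge_cases j c : ge (- j) c -> ge (- (j - 1)) c \/ (c != 0 /\ v c = - j).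
Proof.
have [->|c0] := eqVneq c 0; first by left; exact: val_ge0.
rewrite !val_geE // => jc; have [h|h] := eqVneq (v c) (- j); first by right.
by left; lia.
Qed.

Lemma bezout_p (z : int) : ~~ (p %| z)%Z ->
  exists w w' : int, w * z + w' * p%:Z = 1.
Proof.
move=> pz; have pr := pcharf_prime pcharK.
have : coprimez z p.
  rewrite /coprimez /gcdz /= eqz_nat -[_ == _]/(coprime `|z| p).
  by rewrite coprime_sym prime_coprime.
by case/coprimezP => -[w w'] /= h; exists w, w'.
Qed.

Lemma sy_bezout a b (z : int) : b != 0 -> ~~ (p %| z)%Z ->
  exists w, sy a b *~ z *~ w = sy a b.
Proof.
move=> b0 /bezout_p[w [w' h]]; exists w.
have : sy a b *~ (w * z + w' * p%:Z) = sy a b by rewrite h.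
rewrite mulrzDr [w' * _]mulrC [w * z]mulrC !mulrzA -[_ *~ p%:Z]pmulrn.
by rewrite sy_p // mul0rz addr0.
Qed.

(** If c = pi^(-j) u, expanding {c, c} = 0 gives j {c, pi} = {c, u}, and [j] is invertible on
    symbols, which are killed by [p]. *)
Lemma leading_pi j c : ~~ (p %| j)%Z -> ge (- j) c -> leading j (sy c pi).
Proof.
move=> pj jc; case: (ge_cases jc) => [jc1|[c0 vc]].
  by apply: leading_fil; exact: fil_sy.
have [w <-] := sy_bezout c pi0 pj; apply: leadingMz.
have [u [u0 vu cE]] := unif_decomp c0.
have := sy_self c0; rewrite {2}cE syM ?expfz_neq0 // syXz // vc mulrNz addrC.
by move/eqP; rewrite subr_eq0 => /eqP <-; exact: leading_unit.
Qed.

Lemma fil_leading j g : fil j g ->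
  exists2 c, ge (- j) c & leading j (g - sy c pi).
Proof.
case=> s + ->; elim: s => [|[a b] s IHs] /=.
  move=> _; exists 0; first exact: val_ge0.
  by rewrite big_nil sy0 // subr0; exact/leading_fil/fil0.
case/andP=> /andP[b0 ja] /IHs[c jc lc]; rewrite big_cons /=.
exists (a *~ v b + c); first by apply: val_geD => //; exact: val_geMz.
have [u [u0 vu bE]] := unif_decomp b0.
rewrite syD // opprD addrACA; apply: leadingD => //.
rewrite {1}bE syM ?expfz_neq0 // syXz // syMz // addrC addKr.
exact: leading_unit.
Qed.

Variable m : nat.

(** Two conditions are carried along the descent: one [a i0] keeps its pole of order [m], which
    serves to absorb the terms in [pi], and [b k] stays congruent to [t k], so that {c, b k} and {c,
    t k} agree up to a term of lower degree. *)
Definition adapted (j : int) (g : G) : Prop := exists (a b : 'I_n -> K) (i0 : 'I_n),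
  [/\ a i0 != 0 /\ v (a i0) = - m%:Z,
      forall k, b k != 0 /\ ge 1 (b k / t k - 1) &
      fil j (g - \sum_k sy (a k) (b k))].

(** Since d1 = 0, the differentials of [e] and of [e - 1] coincide, and the latter element lies in
    the maximal ideal. *)
Lemma fil_near1 j c e : e != 0 -> ge 1 (e - 1) -> ge (- j) c -> fil (j - 1) (sy c e).
Proof.
move=> e0 e1 jc; have ve : v e = 0 by rewrite -[e](subrK 1) addrC dval_1D.
rewrite syd_div // -{2}[e](subrK 1) sydD; apply: filD.
  by apply: syd_max => //; exact: val_ge_divu.
by rewrite /syd oner_eq0 mulr1 sy1; exact: fil0.
Qed.

(* When p divides j, the term sy c pi of degree j is produced by multiplying
   b i0 by 1 + w, where a i0 * w is c up to a scalar; the scalar m - j is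
   prime to p. *)
Lemma adapt_pi (j : int) (a1 c : K) : ~~ (p %| m)%N -> (j < m%:Z) -> (p %| j)%Z ->
  a1 != 0 -> v a1 = - m%:Z -> c != 0 -> v c = - j ->
  exists2 w, ge 1 w & leading j (sy a1 (1 + w) - sy c pi).
Proof.
move=> pm jm pj a10 va1 c0 vc; pose d : int := m%:Z - j.
have pd : ~~ (p %| d)%Z.
  apply: contra pm => pd; rewrite -[(p %| m)%N]/(p %| m%:Z)%Z -(subrK j m%:Z).
  exact: rpredD.
(* [z] is an inverse of [d] modulo [p], so that [c'] is [c] divided by the scalar [d]. *)
have [z [z' zE]] := bezout_p pd; pose c' := c *~ z.
have c'E : c' *~ d = c.
  have : c *~ (z * d + z' * p%:Z) = c by rewrite zE.
  rewrite mulrzDr [z' * _]mulrC !mulrzA -[_ *~ p%:Z]pmulrn -mulr_natr.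
  by rewrite (pcharf0 pcharK) mulr0 mul0rz addr0.
have c'0 : c' != 0 by apply: contraNneq c0 => c'0; rewrite -c'E c'0 mul0rz.
have vc' : v c' = - j.
  have h1 : ge (- j) c' by apply: val_geMz => //; rewrite val_geE // vc.
  have h2 : ge (v c') c by rewrite -c'E; apply: val_geMz => //; rewrite val_geE.
  by move: h1 h2; rewrite !val_geE // vc => h1 h2; apply/eqP; rewrite eq_le h2.
pose w := c' / a1; have w0 : w != 0 by rewrite mulf_neq0 ?invr_neq0.
have vw : v w = d by rewrite (dvalM dv) ?invr_neq0 // dvalV // vc' va1 opprK addrC.
have w1 : ge 1 w by rewrite val_geE // vw /d; lia.
have w10 := val_ge1_neq0 dv w1; exists w => //.
rewrite syd_div // sydD {1}/syd oner_eq0 mulr1 sy1 add0r /syd (negPf w0).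
have -> : a1 / (1 + w) * w = c' - c' * w / (1 + w).
  have -> : a1 / (1 + w) * w = c' / (1 + w) by rewrite mulrAC [a1 * w]mulrC divfK.
  apply: (mulIf w10); rewrite mulrBl !divfK // mulrDr mulr1 addrK //.
(* The symbol {a1, 1 + w} has become {c', w} minus {c' w / (1 + w), w}. As w = pi^d u, the first is
   d {c', pi} + {c', u} = {c, pi} + {c', u}; the second has degree below [j] because w lies in the
   maximal ideal. *)
have [u [u0 vu wE]] := unif_decomp w0.
rewrite syD // syN // {1}wE syM ?expfz_neq0 // syXz // vw -syMz // c'E.
rewrite addrAC [sy c pi + _]addrC addrK.
apply: leadingD; first by apply: leading_unit => //; rewrite val_geE // vc'.
apply/leadingN/leading_fil/fil_sy => //; apply: val_ge_divu; rewrite ?dval_1D //.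
by rewrite opprB addrC; apply: val_geM => //; rewrite val_geE // vc'.
Qed.

Lemma adapted_step j g : ~~ (p %| m)%N -> j < m%:Z ->
  adapted j g -> adapted (j - 1) g.
Proof.
move=> pm jm [a [b [i0 [[a0 va] hb fg]]]].
have [b' hb' [c jc fc]] : exists2 b' : 'I_n -> K,
    forall k, b' k != 0 /\ ge 1 (b' k / t k - 1) &
    leading j (g - \sum_k sy (a k) (b' k)).
  have [c jc lc] := fil_leading fg.
  have [lcpi|[pj [c0 vc]]] : leading j (sy c pi) \/ ((p %| j)%Z /\ c != 0 /\ v c = - j).
    have [pj|pj] := boolP (p %| j)%Z; last by left; exact: leading_pi.
    case: (ge_cases jc) => [jc1|[c0 vc]]; last by right.
    by left; apply/leading_fil/fil_sy.
    exists b => //; have := leadingD lc lcpi; by rewrite subrK.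
  have [w w1 lw] := adapt_pi pm jm pj a0 va c0 vc; have w10 := val_ge1_neq0 dv w1.
  exists (fun k => if k == i0 then b k * (1 + w) else b k) => [k|].
    have [bk0 bk1] := hb k; have [_|_] := eqVneq k i0; last by split.
    split; first by rewrite mulf_neq0.
    have -> : b k * (1 + w) / t k - 1 = (b k / t k - 1) * (1 + w) + w.
      by rewrite mulrAC mulrBl mul1r opprD addrA subrK.
    apply: val_geD => //; have w1' : ge 0 (1 + w) by rewrite val_geE // dval_1D.
    by have := val_geM dv bk1 w1'; rewrite addr0.
  have -> : \sum_k sy (a k) (if k == i0 then b k * (1 + w) else b k) =
      \sum_k sy (a k) (b k) + sy (a i0) (1 + w).
    rewrite (bigD1 i0) //= eqxx [in RHS](bigD1 i0) //= syM ?(hb i0).1 //.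
    rewrite addrAC; congr (_ + _ + _).
    by apply: eq_bigr => k /negPf->.
  have := leadingD lc (leadingN lw).
  by rewrite opprB addrA subrK opprD addrA.
have gt0 k : t k != 0 := (t_unit k).1.
exists (fun k => a k + c k), b', i0; split=> //.
  (* The correction [c i0] has valuation at least -j, which exceeds -m, so the pole of order [m]
     survives. *)
  have [|h ->] := dval_addl dv a0 (y := c i0); last by rewrite va.
  by apply: val_ge_mono (jc i0); rewrite va; lia.
(* The corrections enter with second entry [b' k] instead of [t k]; the discrepancy {c k, b' k / t
   k} lies in [fil (j - 1)] by [fil_near1]. *)
have -> : \sum_k sy (a k + c k) (b' k) = \sum_k sy (a k) (b' k) +
    (\sum_k sy (c k) (t k) + \sum_k sy (c k) (b' k / t k)).
  rewrite -!big_split; apply: eq_bigr => k _ /=; have [bk0 _] := hb' k.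
  have bt0 : b' k / t k != 0 by rewrite mulf_neq0 ?invr_neq0.
  by rewrite syD // -syM // [t k * _]mulrC divfK.
rewrite !opprD addrA [X in fil _ X]addrA; apply: filD => //; apply: filN.
elim/big_ind: _ => [|x y|k _]; [exact: fil0|exact: filD|].
have [bk0 bk1] := hb' k; apply: fil_near1 => //.
by rewrite mulf_neq0 ?invr_neq0.
Qed.

(** The first alternative occurs when no leading coefficient has valuation exactly -m; minimality of
    the Swan conductor excludes it in the application. *)
Theorem symbol_length g : ~~ (p %| m)%N -> fil m%:Z g ->
  fil (m%:Z - 1) g \/
  exists a b : 'I_n -> K, (forall k, b k != 0) /\ g = \sum_k sy (a k) (b k).
Proof.
move=> pm fg; have [c jc lc] := fil_leading fg.
have [d jd fd] : leading m%:Z g.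
  have pmz : ~~ (p %| m%:Z)%Z by [].
  by have := leadingD lc (leading_pi pmz jc); rewrite subrK.
have [/existsP[i0 /andP[d0 /eqP vd]]|/existsPn h] :=
    boolP [exists k, (d k != 0) && (v (d k) == - m%:Z)]; last first.
  left; rewrite -[g](subrK (\sum_k sy (d k) (t k))); apply: filD => //.
  elim/big_ind: _ => [|x y|k _]; [exact: fil0|exact: filD|].
  apply: fil_sy; first exact: (t_unit k).1.
  by case: (ge_cases (jd k)) => // -[d0 vd]; have := h k; rewrite d0 vd eqxx.
(* The descent starts in degree m - 1 with the second entries [t k] themselves; [k = m] reaches
   degree -1. *)
right; have ad (k : nat) : adapted (m%:Z - 1 - k%:Z) g.
  elim: k => [|k IHk].
    exists d, t, i0; split=> // [k|]; last by rewrite subr0.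
    by rewrite divff ?(t_unit k).1 // subrr val_ge0; split=> //; exact: (t_unit k).1.
  have -> : m%:Z - 1 - k.+1%:Z = (m%:Z - 1 - k%:Z) - 1 by lia.
  by apply: adapted_step => //; lia.
have [a [b [_ [_ hb]]]] := ad m; have -> : m%:Z - 1 - m%:Z = - 1 by lia.
case=> s hs gE; exists a, b; split=> [k|]; first exact: (hb k).1.
apply/eqP; rewrite -subr_eq0 gE big1_seq // => -[x y] /= /(allP hs) /andP[y0 x1].
exact: sy_max.
Qed.

End SymbolFiltration.

(** * Generators of a field over its subfield of p-th powers *)

Section InseparableGenerators.

Variables (F : fieldType) (L : fieldExtType F) (p : nat).
Hypothesis pcharL : p \in [pchar L].
Hypothesis expL : forall x : L, x ^+ p \in 1%VS.
Hypothesis scalar_exp : forall c : F, exists x : L, c%:A = x ^+ p.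

(** Generation over the p-th powers is expressed as an induction principle, the form in which
    [leading_syd] consumes it. *)
Definition closed_ops (R : nzRingType) (P : R -> Prop) : Prop :=
  [/\ forall x, P (x ^+ p), forall x y, P x -> P y -> P (x + y) &
      forall x y, P x -> P y -> P (x * y)].

(** The minimal polynomial divides X^p - x^p = (X - x)^p, hence equals (X - x)^k for some k. If k <
    p, its coefficient -k x lies in [E] and k is invertible, so that x would lie in [E]. *)
Lemma adjoin_degree_insep (E : {subfield L}) (x : L) :
  x \notin E -> adjoin_degree E x = p.
Proof.
move=> xE; set j := adjoin_degree E x.
have Exp : x ^+ p \in E by apply: subvP (sub1v E) _ _; exact: expL.
have XpE : 'X^p - (x ^+ p)%:P = ('X - x%:P) ^+ p.
  have cP : p \in [pchar {poly L}] by rewrite pchar_poly.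
  by rewrite polyC_exp; exact: esym (rmorphB (pFrobenius_aut cP) 'X x%:P).
have dvd : minPoly E x %| ('X - x%:P) ^+ p.
  rewrite -XpE; apply: minPoly_dvdp.
    by rewrite rpredB ?rpredX ?polyOverX // polyOverC.
  by rewrite /root !hornerE subrr.
have /dvdp_exp_XsubCP[k kp] := dvd.
rewrite eqp_monic ?monic_minPoly ?monic_exp ?monicXsubC // => /eqP mE.
have jk : j = k by have := size_minPoly E x; rewrite mE size_exp_XsubC => -[].
have k0 : (0 < k)%N by rewrite -jk.
move: kp; rewrite jk leq_eqVlt => /orP[/eqP//|kp].
case/negP: xE; have := minPolyOver E x; rewrite mE => /polyOverP/(_ k.-1).
have -> : (('X - x%:P) ^+ k)`_k.-1 = - (x *+ k).
  have := @coefPn_prod_XsubC _ (nseq k x); rewrite size_nseq -lt0n => /(_ k0).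
  by rewrite !big_nseq !iter_addr_0 -Monoid.iteropE.
rewrite rpredN -mulr_natr -[X in X \in _]/(_ * _) => h.
have kn0 : (k%:R : L) != 0 by rewrite -(dvdn_pcharf pcharL) gtnNdvd.
by rewrite -[x](mulfK kn0) rpredM // rpredV rpred_nat.
Qed.

(** Adjoining an element outside the current subfield multiplies the dimension by [p], so [n] steps
    exhaust [L]. Elements of a simple extension are polynomials in the new element, whence closure
    under sums and products suffices. *)
Lemma insep_generators n : \dim {:L} = (p ^ n)%N ->
  exists t : 'I_n -> L, forall P : L -> Prop, closed_ops P ->
    (forall k, P (t k)) -> forall x, P x.
Proof.
move=> dL; have p_gt1 : (1 < p)%N := prime_gt1 (pcharf_prime pcharL).
have chain k : (k <= n)%N -> exists2 ts : seq L, size ts = k &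
    exists2 E : {subfield L}, \dim E = (p ^ k)%N &
    forall P : L -> Prop, closed_ops P -> (forall u, u \in ts -> P u) ->
    forall x, x \in E -> P x.
  elim: k => [|k IHk] kn.
    exists [::] => //; exists 1%AS; first by rewrite dimv1 expn0.
    move=> P [PX _ _] _ x /vlineP[c ->].
    by have [y ->] := scalar_exp c.
  have [ts sts [E dE genE]] := IHk (ltnW kn).
  have : ~~ (fullv <= E)%VS.
    by apply: contraTN kn => /dimvS; rewrite dL dE leq_exp2l // -leqNgt.
  case/subvPn => t _ tE; exists (t :: ts); rewrite /= ?sts //.
  exists <<E; t>>%AS; first by rewrite dim_Fadjoin adjoin_degree_insep // dE expnS.
  move=> P cP Pts x /Fadjoin_poly_eq xE; have [PX PD PM] := cP.
  have P1 : P 1 by have := PX 1; rewrite expr1n.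
  have P0 : P 0 by have := PX 0; rewrite expr0n gtn_eqF // ltnW.
  have PtX i : P (t ^+ i).
    elim: i => [|i IHi]; first by rewrite expr0.
    by rewrite exprS; apply: PM => //; apply: Pts; rewrite mem_head.
  rewrite -xE horner_coef; elim/big_ind: _ => // i _; apply: PM => //.
  apply: genE => // [u uts|]; first by apply: Pts; rewrite inE uts orbT.
  by have /polyOverP := Fadjoin_polyOver E t x; apply.
have [ts sts [E dE genE]] := chain n (leqnn n).
exists (fun k => nth 0 ts k) => P cP Pt x; apply: genE => //.
  by move=> u /(nthP 0)[i]; rewrite sts => ni <-; exact: Pt (Ordinal ni).
suff -> : (E : {vspace L}) = fullv by rewrite memvf.
by apply/eqP; rewrite eqEdim subvf dL dE leqnn.
Qed.

End InseparableGenerators.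

(* F as an algebra over itself through the Frobenius endomorphism; the unused
   arguments make the structures below inferable. *)
Definition frob_type (F : fieldType) (p d : nat) (_ : p \in [pchar F])
  (e : 'I_d -> F)
  (_ : forall x : F, exists! c : {ffun 'I_d -> F}, x = \sum_(i < d) c i ^+ p * e i)
  : Type := F.

Section FrobeniusAlgebra.

Variables (F : fieldType) (p d : nat) (pcharF : p \in [pchar F]).
Variable e : 'I_d -> F.
Hypothesis eP : forall x : F,
  exists! c : {ffun 'I_d -> F}, x = \sum_(i < d) c i ^+ p * e i.

Local Notation L := (frob_type pcharF eP).

HB.instance Definition _ := GRing.Field.on L.

Definition frob_scale (c : F) (x : L) : L := c ^+ p * x :> F.

Lemma frob_scaleA a b x : frob_scale a (frob_scale b x) = frob_scale (a * b) x.
Proof. by rewrite /frob_scale mulrA exprMn. Qed.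
Lemma frob_scale1 : left_id 1 frob_scale.
Proof. by move=> x; rewrite /frob_scale expr1n mul1r. Qed.
Lemma frob_scaleDr : right_distributive frob_scale +%R.
Proof. by move=> c x y; rewrite /frob_scale mulrDr. Qed.
Lemma frob_scaleDl x : {morph frob_scale^~ x : a b / a + b}.
Proof.
move=> a b; rewrite /frob_scale -mulrDl; congr (_ * _).
exact: (rmorphD (pFrobenius_aut pcharF)).
Qed.

HB.instance Definition _ := GRing.Zmodule_isLmodule.Build F L
  frob_scaleA frob_scale1 frob_scaleDr frob_scaleDl.

Lemma frob_scaleAl (c : F) (x y : L) : c *: (x * y) = c *: x * y.
Proof. exact: mulrA. Qed.

HB.instance Definition _ := GRing.Lmodule_isLalgebra.Build F L frob_scaleAl.

Lemma frob_scaleAr (c : F) (x y : L) : c *: (x * y) = x * (c *: y).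
Proof. exact: mulrCA. Qed.

HB.instance Definition _ := GRing.Lalgebra_isAlgebra.Build F L frob_scaleAr.

(** Uniqueness of the coefficients makes the chosen coordinates linear for the scalars twisted by
    Frobenius. *)
Lemma frob_vector_axiom : Vector.axiom d L.
Proof.
have exb (x : L) : exists c : {ffun 'I_d -> F}, x == \sum_(i < d) c i ^+ p * e i :> F.
  by have [c [/eqP cE _]] := eP x; exists c.
pose co (x : L) := xchoose (exb x).
have coE x : \sum_(i < d) co x i ^+ p * e i = x by apply/esym/eqP/(xchooseP (exb x)).
have coU (c : {ffun 'I_d -> F}) x : x = \sum_(i < d) c i ^+ p * e i -> co x = c.
  by have [c0 [_ uniq]] := eP x => h; rewrite -(uniq _ h); apply/esym/uniq; rewrite coE.
exists (fun x => \row_i co x i).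
  move=> c x y; apply/rowP => i; rewrite !mxE.
  rewrite (coU [ffun i => c * co x i + co y i]) ?ffunE //.
  have -> : c *: x + y = c ^+ p * (x : F) + (y : F) by [].
  rewrite -{1}[x]coE -{1}[y]coE mulr_sumr -big_split; apply: eq_bigr => k _ /=.
  rewrite ffunE mulrA -exprMn -mulrDl; congr (_ * _).
  exact: esym (rmorphD (pFrobenius_aut pcharF) _ _).
exists (fun w : 'rV[F]_d => \sum_(i < d) w 0 i ^+ p * e i : L) => [x|w].
  by under eq_bigr do rewrite mxE; rewrite coE.
apply/rowP => i; rewrite mxE (coU [ffun i => w 0 i]) ?ffunE //.
by apply: eq_bigr => k _; rewrite ffunE.
Qed.

HB.instance Definition _ := Lmodule_hasFinDim.Build F L frob_vector_axiom.

Lemma frob_type_dim : \dim {:L} = d.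
Proof. by rewrite dimvf. Qed.

Lemma frob_type_generators n : d = (p ^ n)%N ->
  exists t : 'I_n -> F, forall P : F -> Prop, closed_ops p P ->
    (forall k, P (t k)) -> forall x, P x.
Proof.
move=> dE; have scal (c : F) : c%:A = (c : L) ^+ p :> L by exact: mulr1.
apply: (@insep_generators F (L : fieldExtType F) p).
- exact: pcharF.
- by move=> x; rewrite -(scal x); apply: memvZ; exact: mem1v.
- by move=> c; exists (c : L).
by rewrite frob_type_dim.
Qed.

End FrobeniusAlgebra.

Lemma frob_generators (F : fieldType) p n :
  p \in [pchar F] -> frob_degree F p (p ^ n) ->
  exists t : 'I_n -> F, forall P : F -> Prop, closed_ops p P ->
    (forall k, P (t k)) -> forall x, P x.
Proof. by move=> pcharF [e eP]; exact: (frob_type_generators pcharF eP). Qed.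

(** * Divisibility of the index by counting dimensions *)

Section Index.

Variable K : fieldType.
Implicit Types A B C D S T : falgType K.

(** [U] is the direct sum of its images under the idempotents [E i i], and [E ord0 i] carries the
    i-th image isomorphically to the one of index 0. *)
Lemma matrix_units_dim (V : vectType K) (q : nat) (E : 'I_q.+1 -> 'I_q.+1 -> 'End(V))
    (U : {vspace V}) :
  (forall i j k l x, E i j (E k l x) = if j == k then E i l x else 0) ->
  (forall x, \sum_i E i i x = x) -> (forall i j x, x \in U -> E i j x \in U) ->
  \dim U = (q.+1 * \dim (E ord0 ord0 @: U))%N.
Proof.
move=> EE E1 UE; have sumU : U = (\sum_i E i i @: U)%VS.
  apply/eqP; rewrite eqEsubv; apply/andP; split; apply/subvP => x.
    by move=> xU; rewrite -[x]E1; apply: memv_sumr => i _; exact: memv_img.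
  case/memv_sumP => u hu ->; apply: memv_suml => i _.
  by case/memv_imgP: (hu i isT) => y yU ->; exact: UE.
have dir : directv (\sum_i E i i @: U).
  apply/directv_sum_independent => u hu u0 i _.
  have Eu k l : E k k (u l) = if k == l then u l else 0.
    by case/memv_imgP: (hu l isT) => y _ ->; rewrite EE; case: eqP => [->|].
  have := congr1 (E i i) u0; rewrite linear_sum linear0 (bigD1 i) //= Eu eqxx.
  rewrite big1 ?addr0 // => k ki; rewrite Eu.
  by rewrite eq_sym (negPf ki).
rewrite {1}sumU (directvP dir) /= -[X in (X * _)%N]card_ord -sum_nat_const.
apply: eq_bigr => i _.
transitivity (\dim (E ord0 i @: (E i i @: U))).
  rewrite [RHS]limg_dim_eq //; apply/eqP; rewrite -subv0; apply/subvP => x.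
  rewrite memv_cap memv_ker => /andP[/memv_imgP[y _ ->] /eqP h].
  by have := congr1 (E i ord0) h; rewrite linear0 !EE !eqxx memv0 => ->.
congr (\dim _); apply/eqP; rewrite eqEsubv; apply/andP; split; apply/subvP => x.
  case/memv_imgP => _ /memv_imgP[y yU ->] ->; rewrite EE eqxx.
  by have := EE ord0 ord0 ord0 i y; rewrite eqxx => <-; apply: memv_img; exact: UE.
case/memv_imgP => y yU ->; have := EE ord0 i i ord0 y; rewrite eqxx => <-.
apply: memv_img; have := EE i i i ord0 y; rewrite eqxx => <-.
by apply: memv_img; exact: UE.
Qed.

(** [U] is a right vector space over [D]: a stable subspace [W] is enlarged by x D for some x
    outside [W], which meets [W] trivially because [D] is a division algebra, and each step adds
    [dim D]. *)
Lemma division_dim D C (f : D -> C) (U : {vspace C}) :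
  (forall x : D, x != 0 -> x \is a GRing.unit) -> algebra_morphism f ->
  (forall x d, x \in U -> x * f d \in U) -> (dim D %| \dim U)%N.
Proof.
move=> divD mf stU; have [F fF] := algebra_morphismP mf.
suff gen k (W : {vspace C}) : (W <= U)%VS -> (forall x d, x \in W -> x * f d \in W) ->
    (dim D %| \dim W)%N -> (\dim U - \dim W <= k)%N -> (dim D %| \dim U)%N.
  apply: (gen (\dim U) 0%VS); rewrite ?sub0v ?dimv0 ?dvdn0 ?leq_subr //.
  by move=> x d; rewrite !memv0 => /eqP->; rewrite mul0r.
elim: k W => [|k IHk] W WU stW dW; have [UW|nUW] := boolP (U <= W)%VS.
- by have -> : U = W by apply/eqP; rewrite eqEsubv UW.
- rewrite leqn0 subn_eq0 => h; case/negP: nUW.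
  by suff /eqP-> : W == U by []; rewrite eqEdim WU.
- by have -> : U = W by apply/eqP; rewrite eqEsubv UW.
case/subvPn: nUW => x xU xW hk.
pose X := limg (amull x \o linfun F)%VF.
have XP y : reflect (exists d, y = x * f d) (y \in X).
  apply: (iffP memv_imgP) => [[d _ ->]|[d ->]]; exists d; rewrite ?memvf //.
    by rewrite comp_lfunE !lfunE /= fF.
  by rewrite comp_lfunE !lfunE /= fF.
have unit_inv d y : d != 0 -> y * f d \in W -> y \in W.
  move=> d0 /(stW _ d^-1); case: mf => _ mM f1.
  by rewrite -mulrA -mM mulrV ?divD // f1 mulr1.
have dX : \dim X = dim D.
  rewrite limg_dim_eq ?dimvf //; apply/eqP; rewrite -subv0; apply/subvP => d.
  rewrite memv_cap memv_ker comp_lfunE !lfunE /= -fF memv0 => /andP[_ /eqP h].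
  by apply: contraNT xW => d0; apply: (unit_inv d) => //; rewrite h mem0v.
have WX0 : (W :&: X)%VS = 0%VS.
  apply/eqP; rewrite -subv0; apply/subvP => y; rewrite memv_cap memv0.
  case/andP=> yW /XP[d yE]; have [d0|d0] := eqVneq d 0.
    by rewrite yE d0 fF linear0 mulr0.
  by case/negP: xW; apply: (unit_inv d) => //; rewrite -yE.
have dWX := dimv_disjoint_sum WX0.
apply: (IHk (W + X)%VS).
- rewrite subv_add WU; apply/subvP => y /XP[d ->]; exact: stU.
- move=> y d /memv_addP[w wW [z /XP[d' ->] ->]]; rewrite mulrDl memv_add ?stW //.
  by apply/XP; exists (d' * d); case: mf => _ mM _; rewrite mM mulrA.
- by rewrite dWX dX dvdn_add.
have D0 : (0 < dim D)%N.
  rewrite -dimvf lt0n dimv_eq0; apply/eqP => h.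
  by have := memvf (1 : D); rewrite h memv0 oner_eq0.
by rewrite dWX dX; lia.
Qed.

(* For the right ideal I = E_00 C, where E_00 is a matrix unit of M_r, counting
   dimensions in C = S (x) M_r gives dim C = r dim I, while in C = D (x) M_s it
   gives s d^2 | dim I. *)
Lemma division_index_dvd D S (d N : nat) :
  (forall x : D, x != 0 -> x \is a GRing.unit) -> brauer_equiv D S ->
  dim D = (d ^ 2)%N -> dim S = (N ^ 2)%N -> (d %| N)%N.
Proof.
move=> divD DS dD dS.
have [M [M' [[s isoM] [r isoM'] DMSM]]] := DS.
pose C := tensor S 'M[K]_r.+1.
have isoC : iso (tensor D 'M[K]_s.+1) C.
  apply: iso_trans (tensor_congr (iso_refl _) (iso_sym isoM)) _.
  exact: iso_trans DMSM (tensor_congr (iso_refl _) isoM').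
have dC : (dim C = d ^ 2 * (s.+1 * s.+1))%N.
  by rewrite -(iso_dim isoC) dim_tensor dim_matrix dD.
have dC' : (dim C = N ^ 2 * (r.+1 * r.+1))%N by rewrite dim_tensor dim_matrix dS.
case: isoC => h [mh _].
pose f := h \o @tensor_inl K D 'M[K]_s.+1; pose g := h \o @tensor_inr K D 'M[K]_s.+1.
have mf : algebra_morphism f := morphism_comp (tensor_inl_morphism _ _) mh.
have mg : algebra_morphism g := morphism_comp (tensor_inr_morphism _ _) mh.
have fg a b : f a * g b = g b * f a.
  by case: mh => _ hM _; rewrite /= -!hM tensor_inlr tensor_inrl.
have mk := tensor_inr_morphism S 'M[K]_r.+1.
have unitsE q (k : 'M[K]_q.+1 -> C) : algebra_morphism k ->
    (forall i j i' j', k (delta_mx i j) * k (delta_mx i' j') =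
       if j == i' then k (delta_mx i j') else 0) /\ \sum_i k (delta_mx i i) = 1.
  case/algebra_morphismP => k' kE; split=> [i j i' j'|].
    rewrite !kE -rmorphM -mulmxE mul_delta_mx_cond; case: eqP => _; first by rewrite mulr1n.
    by rewrite mulr0n raddf0.
  by under eq_bigr do rewrite kE; rewrite -linear_sum sum_delta_mx rmorph1.
have [EE E1] := unitsE _ _ mk; have [GG G1] := unitsE _ _ mg.
pose I := (amull (tensor_inr S (delta_mx ord0 ord0)) @: {:C})%VS.
have dI : (dim C = r.+1 * \dim I)%N.
  rewrite -dimvf.
  apply: (@matrix_units_dim _ r (fun i j => amull (tensor_inr S (delta_mx i j))) {:C}).
  - move=> i j k l x; rewrite !lfunE /= mulrA EE; case: eqP => // _.
    by rewrite mul0r.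
  - by move=> x; under eq_bigr do rewrite lfunE /=; rewrite -mulr_suml E1 mul1r.
  by move=> *; rewrite memvf.
have stI x c : x \in I -> x * c \in I.
  case/memv_imgP => y _ ->; rewrite lfunE /= -mulrA.
  by apply/memv_imgP; exists (y * c); rewrite ?memvf // lfunE.
(* Right multiplications by the matrix units coming from the side of [D] cut [I] into s + 1 pieces
   of equal dimension, each a right [D]-space since [D] commutes with them. Right multiplication
   reverses products, whence the transposed [delta_mx j i]. *)
have [k dk] : exists k, \dim I = (s.+1 * (k * d ^ 2))%N.
  rewrite (@matrix_units_dim _ s (fun i j => amulr (g (delta_mx j i))) I).
  - have /dvdnP[k ->] : (dim D %| \dim (amulr (g (delta_mx ord0 ord0)) @: I))%N.
      apply: (division_dim divD mf) => x a /memv_imgP[y yI ->].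
      rewrite lfunE /= -mulrA -fg mulrA; apply/memv_imgP.
      by exists (y * f a); [exact: stI|rewrite lfunE].
    by exists k; rewrite dD.
  - move=> i j i' j' x; rewrite !lfunE /= -mulrA GG eq_sym; case: eqP => // _.
    by rewrite mulr0.
  - by move=> x; under eq_bigr do rewrite lfunE /=; rewrite -mulr_sumr G1 mulr1.
  by move=> i j x xI; rewrite lfunE /=; exact: stI.
have d0 : (0 < d)%N.
  have : (0 < dim D)%N; last by rewrite dD expn_gt0 orbF.
  rewrite -dimvf lt0n dimv_eq0; apply/eqP => h0.
  by have := memvf (1 : D); rewrite h0 memv0 oner_eq0.
(* Both counts of [dim C] give d^2 (s+1)^2 = (r+1) (s+1) k d^2. With N (r+1) = d (s+1), which
   follows by taking square roots, this yields N = d k. *)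
have sE : s.+1 = (r.+1 * k)%N.
  apply/eqP; rewrite -(eqn_pmul2l (m := d ^ 2 * s.+1)) ?muln_gt0 ?expn_gt0 ?d0 //.
  by rewrite -mulnA -dC dI dk; apply/eqP; nia.
have NE : (N * r.+1 = d * s.+1)%N.
  by apply/eqP; rewrite -eqn_sqr !expnMn -!mulnn mulnn in dC dC' *; rewrite -dC' dC.
apply/dvdnP; exists k; apply/eqP; rewrite -(eqn_pmul2r (m := r.+1)) // NE sE.
by apply/eqP; nia.
Qed.

End Index.

Local Open Scope quotient_scope.

(** * The group of Brauer classes of symbols, and the Swan filtration in terms of lists *)

Section SymbolGroup.

Variables (K : fieldType) (p : nat) (pcharK : p \in [pchar K]).
Implicit Types (A B S T : falgType K) (s : seq (K * K)).

Local Notation K1 := (K^o : falgType K).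
Local Notation nonzero := (fun ab : K * K => ab.2 != 0).

(** The value [K] for a zero second entry keeps [symbol_opp] true without conditions, so that
    arbitrary lists of pairs represent group elements. *)
Lemma exists_symbol (ab : K * K) : exists S,
  (ab.2 != 0 -> symbol_algebra p ab.1 ab.2 S) /\ (ab.2 = 0 -> S = K1).
Proof.
have [b0|b0] := eqVneq ab.2 0; first by exists K1.
have [S symS] := exists_symbol_algebra pcharK ab.1 b0; exists S.
by split=> // /eqP; rewrite (negPf b0).
Qed.

Definition symbol (ab : K * K) : falgType K :=
  proj1_sig (constructive_indefinite_description _ (exists_symbol ab)).

Lemma symbolP a b : b != 0 -> symbol_algebra p a b (symbol (a, b)).
Proof. by rewrite /symbol; case: constructive_indefinite_description => S []. Qed.

Lemma symbol_b0 a : symbol (a, 0) = K1.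
Proof.
by rewrite /symbol; case: constructive_indefinite_description => S [_ h] /=; exact: h.
Qed.

Definition symbols s : falgType K := foldr (fun ab S => tensor (symbol ab) S) K1 s.

Lemma symbols1 ab : brauer_equiv (symbols [:: ab]) (symbol ab).
Proof. exact: iso_brauer (tensor1 _). Qed.

Lemma symbols_cat s s' :
  brauer_equiv (symbols (s ++ s')) (tensor (symbols s) (symbols s')).
Proof.
elim: s => [|ab s IHs] /=.
  apply: brauer_trans (iso_brauer (tensorC _ _)).
  exact/brauer_sym/iso_brauer/tensor1.
apply: brauer_trans (brauer_tensor (brauer_refl _) IHs) _.
exact: iso_brauer (tensorA _ _ _).
Qed.

Lemma dim_symbols s : all nonzero s -> dim (symbols s) = ((p ^ size s) ^ 2)%N.
Proof.
elim: s => [|[a b] s IHs] //= /andP[b0 /IHs dS].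
by rewrite dim_tensor dS (symbolP a b0).1 mulnn -expnMn -expnS.
Qed.

(** Brauer equivalence is decided classically because the quotient is taken by a boolean
    relation. *)
Definition symbols_eqb s s' : bool :=
  if excluded_middle_informative (brauer_equiv (symbols s) (symbols s'))
  then true else false.

Lemma symbols_eqP s s' :
  reflect (brauer_equiv (symbols s) (symbols s')) (symbols_eqb s s').
Proof. by rewrite /symbols_eqb; case: excluded_middle_informative => h; constructor. Qed.

Lemma symbols_eq_refl : reflexive symbols_eqb.
Proof. by move=> s; apply/symbols_eqP; exact: brauer_refl. Qed.
Lemma symbols_eq_sym : symmetric symbols_eqb.
Proof. by move=> s s'; apply/symbols_eqP/symbols_eqP; exact: brauer_sym. Qed.
Lemma symbols_eq_trans : transitive symbols_eqb.
Proof.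
move=> s2 s1 s3 /symbols_eqP h /symbols_eqP h'; apply/symbols_eqP.
exact: brauer_trans h h'.
Qed.

Canonical symbols_equiv :=
  EquivRel symbols_eqb symbols_eq_refl symbols_eq_sym symbols_eq_trans.

(** This models the subgroup of Br(K) generated by symbols. The quotient is taken on lists of pairs,
    which form a choice type, rather than on algebras. *)
Definition symbol_group := {eq_quot symbols_equiv}.
HB.instance Definition _ := Choice.on symbol_group.
HB.instance Definition _ := EqQuotient.on symbol_group.

Local Notation G := symbol_group.
Local Notation cl := (\pi_symbol_group).

Lemma cl_eqP s s' : cl s = cl s' <-> brauer_equiv (symbols s) (symbols s').
Proof.
split=> [/eqmodP|h]; first by move/symbols_eqP.
by apply/eqmodP/symbols_eqP.
Qed.

Definition group_zero : G := cl [::].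
Definition group_add (g h : G) : G := cl (repr g ++ repr h).
Definition group_opp (g : G) : G := cl [seq (- ab.1, ab.2) | ab <- repr g].

Lemma repr_equiv s : brauer_equiv (symbols (repr (cl s))) (symbols s).
Proof. by apply/cl_eqP; rewrite reprK. Qed.

Lemma cl_cat s s' : group_add (cl s) (cl s') = cl (s ++ s').
Proof.
apply/cl_eqP; apply: brauer_trans (symbols_cat _ _) _.
apply: brauer_trans (brauer_sym (symbols_cat _ _)).
by apply: brauer_tensor; exact: repr_equiv.
Qed.

Lemma group_addA : associative group_add.
Proof.
move=> x y z; rewrite -(reprK x) -(reprK y) -(reprK z).
rewrite (cl_cat (repr y) (repr z)) (cl_cat (repr x) (repr y)).
by rewrite (cl_cat (repr x)) (cl_cat (repr x ++ repr y)) catA.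
Qed.

Lemma group_addC : commutative group_add.
Proof.
move=> x y; rewrite -(reprK x) -(reprK y) !cl_cat; apply/cl_eqP.
apply: brauer_trans (symbols_cat _ _) _.
apply: brauer_trans (brauer_sym (symbols_cat _ _)).
exact: iso_brauer (tensorC _ _).
Qed.

Lemma group_add0 : left_id group_zero group_add.
Proof. by move=> x; rewrite -(reprK x) cl_cat. Qed.

Lemma symbol_split0 b : brauer_equiv (symbol (0, b)) K1.
Proof.
have [->|b0] := eqVneq b 0; first by rewrite symbol_b0; exact: brauer_refl.
exact: matrix_brauer (symbol_0_split pcharK b0 (symbolP 0 b0)).
Qed.

Lemma symbol_opp a b :
  brauer_equiv (tensor (symbol (- a, b)) (symbol (a, b))) K1.
Proof.
have [->|b0] := eqVneq b 0.
  by rewrite !symbol_b0; exact: iso_brauer (tensor1 _).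
apply: brauer_trans (symbol_split0 b).
apply: (symbol_add pcharK b0); try exact: symbolP.
by rewrite addNr; exact: symbolP.
Qed.

Lemma symbols_opp s :
  brauer_equiv (tensor (symbols [seq (- ab.1, ab.2) | ab <- s]) (symbols s)) K1.
Proof.
elim: s => [|[a b] s IHs] /=; first exact: iso_brauer (tensor1 _).
apply: brauer_trans (iso_brauer (tensorACA _ _ _ _)) _.
apply: brauer_trans (brauer_tensor (symbol_opp _ _) IHs) _.
exact: iso_brauer (tensor1 _).
Qed.

Lemma group_addN : left_inverse group_zero group_opp group_add.
Proof.
move=> x; rewrite /group_opp; set s' := map _ _.
rewrite -[X in group_add _ X]reprK cl_cat; apply/cl_eqP.
by apply: brauer_trans (symbols_cat _ _) _; exact: symbols_opp.
Qed.

HB.instance Definition _ := GRing.isZmodule.Build symbol_group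
  group_addA group_addC group_add0 group_addN.

Definition symbol_class (a b : K) : G := cl [:: (a, b)].

Lemma cl_sum s : cl s = \sum_(ab <- s) symbol_class ab.1 ab.2.
Proof.
elim: s => [|[a b] s IHs]; first by rewrite big_nil.
by rewrite big_cons -IHs -[RHS]/(group_add _ _) cl_cat.
Qed.

Lemma symbol_classD a a' b : b != 0 ->
  symbol_class (a + a') b = symbol_class a b + symbol_class a' b.
Proof.
move=> b0; rewrite -[RHS]/(group_add _ _) cl_cat; apply/cl_eqP/brauer_sym.
apply: brauer_trans (brauer_sym (symbols1 _)).
apply: brauer_trans (brauer_tensor (brauer_refl _) (symbols1 _)) _.
by apply: (symbol_add pcharK b0); exact: symbolP.
Qed.

Lemma symbol_classM a b b' : b != 0 -> b' != 0 ->
  symbol_class a (b * b') = symbol_class a b + symbol_class a b'.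
Proof.
move=> b0 b0'; rewrite -[RHS]/(group_add _ _) cl_cat; apply/cl_eqP/brauer_sym.
apply: brauer_trans (brauer_sym (symbols1 _)).
apply: brauer_trans (brauer_tensor (brauer_refl _) (symbols1 _)) _.
by apply: (symbol_mul pcharK b0 b0'); apply: symbolP; rewrite ?mulf_neq0.
Qed.

Lemma symbol_class_self a : a != 0 -> symbol_class a a = 0.
Proof.
move=> a0; apply/cl_eqP; apply: brauer_trans (symbols1 _) _.
exact (symbol_self pcharK a0 (symbolP a a0)).
Qed.

Lemma symbol_class_as c b : b != 0 -> symbol_class (c ^+ p - c) b = 0.
Proof.
move=> b0; apply/cl_eqP; apply: brauer_trans (symbols1 _) _.
exact (symbol_artin_schreier pcharK b0 (symbolP _ b0)).
Qed.

Section Representation.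

Variable v : K -> int.

Local Notation bounded j :=
  (fun ab : K * K => (ab.2 != 0) && val_ge v (- j) ab.1).

Hypothesis dv : discrete_valuation v.

(** Each way of building an element of the filtration is mirrored on lists: sums by concatenation,
    inverses by negating the first entries, with the bound on the valuations preserved. *)
Lemma swan_fil_symbols j A : swan_fil v p j A ->
  exists2 s, all (bounded j%:Z) s & brauer_equiv A (symbols s).
Proof.
elim=> {A} [A|//|A B T _ [s hs As] _ [s' hs' Bs'] /is_tensorP ABT
  |A B T _ [s hs As] _ /is_tensorP ABT /brauer_eqP T0|A B _ [s hs As] _ /brauer_eqP AB].
- case=> a [b [ja b0 /(is_symbol_algebraP pcharK _ _ b0)[dA [x [y xy]]]]].
  exists [:: (a, b)]; first by rewrite /= b0 ja.
  apply: brauer_sym; apply: brauer_trans (symbols1 _) _; apply: iso_brauer.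
  exact (symbol_iso pcharK b0 (symbolP a b0) dA xy).
- by exists [::] => //; exact: brauer_refl.
- exists (s ++ s'); first by rewrite all_cat hs.
  apply: brauer_trans (brauer_sym (iso_brauer ABT)) _.
  apply: brauer_trans (brauer_sym (symbols_cat _ _)).
  exact: brauer_tensor.
(* The tensor product of the negated list with [A] and [B] is equivalent to the negated list,
   because [A] tensored with [B] splits, and to [B], because the negated list tensored with [A]
   splits. *)
- exists [seq (- ab.1, ab.2) | ab <- s].
    rewrite all_map; apply: sub_all hs => -[a b] /= /andP[-> ja].
    exact: val_geN.
  set s' := map _ _.
  have h : brauer_equiv (tensor A B) K1 := brauer_trans (iso_brauer ABT) T0.
  apply: brauer_trans (brauer_tensor0 (symbols s') h).
  apply: brauer_trans (iso_brauer (iso_sym (tensorA _ _ _))).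
  have s'A := brauer_tensor (brauer_refl (symbols s')) (brauer_sym As).
  apply: brauer_trans (brauer_tensor s'A (brauer_refl _)).
  apply: brauer_trans (iso_brauer (tensorC _ _)).
  exact: brauer_sym (brauer_tensor0 _ (symbols_opp s)).
exists s => //; exact: brauer_trans (brauer_sym AB) As.
Qed.

Lemma symbols_swan_fil j A s : central_simple A -> all (bounded j%:Z) s ->
  brauer_equiv A (symbols s) -> swan_fil v p j A.
Proof.
move=> csA hs As; apply: (brauer_gen_eq _ csA (A := symbols s)); last first.
  exact/brauer_eqP/brauer_sym.
elim: s hs {As} => [|[a b] s IHs] /=; first by move=> _; exact: brauer_gen0.
case/andP=> /andP[b0 ja] /IHs h; apply: brauer_genD h _.
  apply: brauer_gen_base; exists a, b; split=> //.
  by apply/(is_symbol_algebraP pcharK) => //; exact: symbolP.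
exact/is_tensorP/iso_refl.
Qed.

End Representation.

Lemma tensor_power_symbols k A T s : is_tensor_power k A T ->
  brauer_equiv A (symbols s) ->
  exists2 s', brauer_equiv T (symbols s') & cl s' = cl s *+ k.
Proof.
move=> + As; elim: k T => [|k IHk] T /=.
  case=> f bf; exists [::] => //; apply/brauer_sym/iso_brauer.
  by exists f; split=> //; exact: lrmorphism_algebra_morphism.
case=> C [/IHk[s' Cs' s'E] /is_tensorP ACT]; exists (s ++ s').
  apply: brauer_trans (brauer_sym (iso_brauer ACT)) _.
  apply: brauer_trans (brauer_sym (symbols_cat _ _)).
  exact: brauer_tensor.
by rewrite mulrS -s'E -[RHS]/(group_add _ _) cl_cat.
Qed.

Lemma torsion_symbols k A s : brauer_torsion k A ->
  brauer_equiv A (symbols s) -> cl s *+ k = 0.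
Proof.
case=> T [AT /brauer_eqP T0] As.
have [s' Ts' <-] := tensor_power_symbols AT As; apply/cl_eqP.
exact: brauer_trans (brauer_sym Ts') T0.
Qed.

End SymbolGroup.

(** * Artin-Schreier equations over a henselian field, and the conclusion *)

(** For f = X^p - X - a, the value f(0) = -a lies in the maximal ideal while f'(0) = -1 is a unit,
    so the approximate root 0 lifts. *)
Lemma henselian_artin_schreier (K : fieldType) (p : nat) (v : K -> int) a :
  p \in [pchar K] -> discrete_valuation v -> henselian v -> val_ge v 1 a ->
  exists c, a = c ^+ p - c.
Proof.
move=> pcharK dv hv a1; pose f : {poly K} := 'X^p - 'X - a%:P.
have p_gt1 := prime_gt1 (pcharf_prime pcharK).
have ge01 : val_ge v 0 1 by rewrite val_geE ?oner_neq0 // dval1.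
have a0 : val_ge v 0 a by exact: val_ge_mono a1.
have geb (b : bool) : val_ge v 0 b%:R by case: b; rewrite ?val_ge0.
have sXa : (size ('X + a%:P : {poly K})%R < size ('X^p : {poly K})%R)%N.
  by rewrite size_XaddC size_polyXn ltnS.
have [|||||c _ [/rootP fc _]] := hv f 0.
- by rewrite /f -addrA -opprD monicE lead_coefDl ?size_polyN // lead_coefXn.
- rewrite qualifE; apply/(all_nthP 0) => i _; rewrite /f !coefB coefXn coefX coefC.
  suff : val_ge v 0 ((i == p)%:R - (i == 1)%:R - (if i == 0 then a else 0)) by [].
  apply: val_geD => //; first apply: val_geD => //.
    by apply: val_geN.
  by apply: val_geN => //; case: eqP => _ //; exact: val_ge0.
- exact: (val_ge0 v 0).
- rewrite -[_ \in _]/(val_ge v 1 _) /f !hornerE expr0n gtn_eqF ?(ltnW p_gt1) //.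
  by rewrite subrr sub0r val_geN.
- rewrite -[_ \notin _]/(~~ val_ge v 1 _) /f !derivE !hornerE.
  rewrite hornerMn -mulr_natr (pcharf0 pcharK) mulr0 sub0r subr0.
  by rewrite val_geE ?oppr_eq0 ?oner_neq0 // dvalN ?oner_neq0 // dval1.
by exists c; move: fc; rewrite /f !hornerE => /eqP; rewrite subr_eq0 => /eqP.
Qed.

Lemma coprime_mulrn_eq0 (V : zmodType) (x : V) m n :
  coprime m n -> x *+ m = 0 -> x *+ n = 0 -> x = 0.
Proof.
move=> cop xm xn; have [m0|m0] := posnP m.
  by move: cop xn; rewrite m0 /coprime gcd0n => /eqP->.
have [km kn e _] := egcdnP n m0.
have : x *+ (m * km)%N = x *+ (n * kn + 1)%N by rewrite mulnC e (eqP cop) mulnC.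
by rewrite mulrnDr !mulrnA xm xn !mul0rn mulr1n add0r.
Qed.

Theorem theorem5p1 (p n : nat) (F K : fieldType) (v : K -> int)
  (A : falgType K) (sw per ind : nat) :
  p \in [pchar F] -> (1 <= n)%N -> frob_degree F p (p ^ n) ->
  p \in [pchar K] -> discrete_valuation v -> henselian v ->
  residue_field v F ->
  central_simple A -> brauer_torsion p A ->
  is_swan v p A sw -> (0 < sw)%N -> ~~ (p %| sw)%N ->
  is_period A per -> is_index A ind ->
  (ind %| per ^ n)%N.
Proof.
move=> pcharF _ Fp pcharK dv hv [r rm] csA Ap [Asw sw_min] sw0 psw.
move=> [per0 Aper per_min] [D [_ divD /brauer_eqP AD dD]].
have [s hs As] := swan_fil_symbols pcharK dv Asw.
(* Minimality of the Swan conductor, transferred to lists; since [sw] is positive, [sw.-1] is truly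
   its predecessor. *)
have not_fil s' : all (fun ab : K * K => (ab.2 != 0) && val_ge v (- sw.-1%:Z) ab.1) s' ->
    ~ brauer_equiv A (symbols pcharK s').
  by move=> hs' /(symbols_swan_fil csA hs')/sw_min; rewrite leqNgt prednK ?leqnn.
(* A smaller period would be prime to [p], so the class would vanish and be represented by the empty
   list, against [not_fil]. *)
have perE : per = p.
  have := per_min p (prime_gt0 (pcharf_prime pcharK)) Ap.
  rewrite leq_eqVlt => /orP[/eqP//|lt_per].
  have h1 := torsion_symbols Ap As; have h2 := torsion_symbols Aper As.
  case: (not_fil [::]) => //; apply: brauer_trans As _; apply/cl_eqP.
  have pr := pcharf_prime pcharK.
  have cop : coprime p per by rewrite prime_coprime // gtnNdvd.
  exact: (coprime_mulrn_eq0 cop h1 h2).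
have [t0 t0_gen] := frob_generators pcharF Fp.
(* The lifts must be units, so a zero generator is replaced by 1; nothing is lost, because 0 is a
   p-th power and [t_gen] starts from all p-th powers. *)
have lift k : exists x, [/\ x != 0, v x = 0 & r x = if t0 k == 0 then 1 else t0 k].
  set y := (if _ then _ else _); have y0 : y != 0.
    by rewrite /y; have [_|//] := eqVneq (t0 k) 0; rewrite oner_neq0.
  have [x xO rx] := res_surj rm y; exists x.
  have : ~~ val_ge v 1 x by rewrite -[val_ge v 1 x]/(x \in val_max v) -(res_ker rm xO) rx.
  have : val_ge v 0 x by [].
  rewrite /val_ge; case: eqP => //= /eqP x0 h1 h2; split=> //; lia.
have [t tP] := fin_all_exists lift.
have [pi pi0 vpi] := dval_unif dv.
have t_unit k : t k != 0 /\ v (t k) = 0 by have [] := tP k.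
have t_gen (P : F -> Prop) : (forall x, P (x ^+ p)) -> (forall k, P (r (t k))) ->
    (forall x y, P x -> P y -> P (x + y)) ->
    (forall x y, P x -> P y -> P (x * y)) -> forall x, P x.
  move=> PX Pt PD PM; apply: t0_gen => // k; have [_ _] := tP k.
  case: eqP => [-> _|_ <- //]; have := PX 0.
  by rewrite expr0n gtn_eqF // prime_gt0 // (pcharf_prime pcharK).
have sy_max a b : b != 0 -> val_ge v 1 a -> symbol_class pcharK a b = 0.
  move=> b0 a1; have [c ->] := henselian_artin_schreier pcharK dv hv a1.
  exact: symbol_class_as.
have fils : fil v (symbol_class pcharK) sw%:Z (\pi_(symbol_group pcharK) s).
  by exists s => //; exact: cl_sum.
have [[s' hs' s'E]|[a [b [b0 gE]]]] := symbol_length pcharK dv rm (symbol_classD pcharK)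
    (symbol_classM pcharK) (symbol_class_self pcharK) sy_max t_unit t_gen pi0 vpi psw fils.
  case: (not_fil s'); first by have -> : sw.-1%:Z = sw%:Z - 1 by lia.
  by apply: brauer_trans As _; apply/cl_eqP; rewrite s'E -cl_sum.
pose s' := [seq (a k, b k) | k <- enum 'I_n].
have As' : brauer_equiv A (symbols pcharK s').
  apply: brauer_trans As _; apply/cl_eqP; rewrite gE [RHS]cl_sum big_map.
  by rewrite big_enum.
have s'0 : all (fun ab : K * K => ab.2 != 0) s'.
  by rewrite all_map; apply/allP => k _ /=; exact: b0.
rewrite perE; apply: (division_index_dvd divD (brauer_trans (brauer_sym AD) As')).
  by rewrite -dimvf.
by rewrite dim_symbols // size_map size_enum_ord.
Qed.
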